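(* Let $H$ and $K$ be connected non-bipartite graphs with disjoint vertex sets $V(H)$ and $V(K)$, respectively. Fix $x\in V(H)$ and $y\in V(K)$. Let $G_{H_x,K_y}$ be the graph with vertex set $V(H)\cup V(K)\cup\{z\}$ and edge set $E(H)\cup E(K)\cup\{\{x,z\},\{y,z\}\}$, where $z\notin V(H)\cup V(K)$. Then $||\mathcal{N}(G_{H_x,K_y})||$ is homotopy equivalent to $||\mathcal{N}(H)||\vee||\mathcal{N}(K)||\vee\mathbb{S}^1$. In particular, $$\mathrm{conn}(||\mathcal{N}(G_{H_x,K_y})||)=0.$$
   Context: For a graph $G$, the neighborhood complex $\mathcal{N}(G)$ is the simplicial complex whose simplices are all subsets of vertices of $G$ which have a common neighbor in $G$. For a simplicial complex $\mathcal{K}$, $||\mathcal{K}||$ denotes its geometric realization. $\mathbb{S}^m$ is the $m$-dimensional sphere and $\mathbb{B}^{m+1}$ the $(m+1)$-dimensional ball, with $\mathbb{S}^{-1}=\emptyset$ and $\mathbb{B}^{-1+1}=\mathbb{B}^0$ a single point. A topological space $X$ is $k$-connected if for every $-1\leq m\leq k$, each continuous map $\mathbb{S}^m\to X$ extends to a continuous map $\mathbb{B}^{m+1}\to X$; thus $(-1)$-connected means nonempty. Equivalently, a nonempty space $X$ is $k$-connected if the homotopy groups $\pi_i(X)$ are trivial for all $i=0,\dots,k$. The largest $k$ such that $X$ is $k$-connected is called the connectivity of $X$ and is denoted $\mathrm{conn}(X)$. The wedge sum $\bigvee_i X_i$ of pointed spaces $(X_i,x_i)$ is the quotient of the disjoint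 union $\coprod_i X_i$ obtained by identifying all the base points $x_i$ to one point. Base points are omitted from the notation. *)

(* Defs.v *)
From HB Require Import structures.
From mathcomp Require Import all_boot all_order all_algebra finmap.
From mathcomp Require Import all_classical reals topology normedtype homotopy.
Import Order.TTheory GRing.Theory Num.Theory numFieldNormedType.Exports.

Set Implicit Arguments.
Unset Strict Implicit.
Unset Printing Implicit Defensive.

Local Open Scope classical_set_scope.
Local Open Scope ring_scope.

(* Simple undirected graphs; the vertex set may be infinite. *)
Record graph (V : choiceType) := Graph {
  adj :> rel V;
  adj_sym : symmetric adj;
  adj_irr : irreflexive adj }.

Definition connected_graph (V : choiceType) (G : graph V) : Prop :=
  forall u v : V, exists2 p : seq V, path G u p & last u p = v.

Definition bipartite (V : choiceType) (G : graph V) : Prop :=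
  exists c : V -> bool, forall u v, G u v -> c u != c v.

Section Join.
Context (V W : choiceType) (H : graph V) (K : graph W) (x : V) (y : W).

(* The sum type makes the vertex sets of H and K disjoint, and None is the
   additional vertex z, joined to x and y only. *)
Definition join_adj (u v : option (V + W)) : bool :=
  match u, v with
  | Some (inl a), Some (inl b) => H a b
  | Some (inr a), Some (inr b) => K a b
  | Some (inl a), None | None, Some (inl a) => a == x
  | Some (inr a), None | None, Some (inr a) => a == y
  | _, _ => false
  end.

Lemma join_adj_sym : symmetric join_adj.
Proof. by move=> [[a|a]|] [[b|b]|] //=; rewrite adj_sym. Qed.

Lemma join_adj_irr : irreflexive join_adj.
Proof. by move=> [[a|a]|] //=; rewrite adj_irr. Qed.

Definition join_graph : graph (option (V + W)) :=
  Graph join_adj_sym join_adj_irr.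
End Join.

(* The empty face may or may not be listed among the simplices; this does not
   affect the geometric realization. *)
Record simplicial_complex (V : choiceType) := SimplicialComplex {
  simplices : set {fset V};
  simplicesS : forall s t : {fset V},
    (t `<=` s)%fset -> simplices s -> simplices t }.

Section NeighborhoodComplex.
Context (V : choiceType) (G : graph V).

(* Simplices are finite, which is automatic when G is finite. *)
Definition common_neighbor : set {fset V} :=
  [set s | exists v : V, forall u : V, u \in s -> G u v].

Lemma common_neighborS (s t : {fset V}) :
  (t `<=` s)%fset -> common_neighbor s -> common_neighbor t.
Proof. by move=> /fsubsetP ts [v sv]; exists v => u /ts /sv. Qed.

Definition neighborhood_complex : simplicial_complex V :=
  SimplicialComplex common_neighborS.
End NeighborhoodComplex.

Section Realization.
Context (R : realType) (V : choiceType) (K : simplicial_complex V).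

(* The closed simplex |s|, in barycentric coordinates. *)
Definition closed_simplex (s : {fset V}) : set (prod_topology (fun _ : V => R)) :=
  [set a | [/\ forall v, 0 <= a v, forall v, v \notin s -> a v = 0
             & \sum_(v <- s) a v = 1]].

Definition realization : Type :=
  set_type (\bigcup_(s in simplices K) closed_simplex s).

HB.instance Definition _ := Choice.copy realization
  (set_type (\bigcup_(s in simplices K) closed_simplex s)).

Definition barycentric (a : realization) : prod_topology (fun _ : V => R) :=
  \val a.

(* The coherent topology: a subset is open when its trace on each closed
   simplex is relatively open for the Euclidean topology of that simplex. For
   a finite complex this is the subspace topology of R^V. *)
Definition realization_open (U : set realization) : Prop :=
  forall s, simplices K s ->
    open (barycentric @` U : set (subspace (closed_simplex s))).

Lemma realization_openT : realization_open setT.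
Proof.
move=> s Ks; apply/open_subspaceP; exists setT; first exact: openT.
rewrite eqEsubset; split => a [_ sa]; split => //.

have Ka : (\bigcup_(s in simplices K) closed_simplex s) a.
  by exists s.
by exists (exist _ a (mem_set Ka)).
Qed.

Lemma realization_openI : setI_closed realization_open.
Proof.
move=> A B oA oB s Ks.
have -> : barycentric @` (A `&` B) = barycentric @` A `&` barycentric @` B.
  rewrite eqEsubset; split => [_ [a [Aa Ba] <-]|a [[b Ab <-] [c Bc cb]]].
    by split; exists a.
  by exists b => //; split => //; rewrite -(val_inj cb).
by apply: openI; [exact: oA|exact: oB].
Qed.

Lemma realization_open_bigU (I : Type) (f : I -> set realization) :
  (forall i, realization_open (f i)) -> realization_open (\bigcup_i f i).
Proof.
move=> of_ s Ks; rewrite image_bigcup.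
by apply: bigcup_open => i _; exact: of_.
Qed.

HB.instance Definition _ := isOpenTopological.Build realization
  realization_openT realization_openI realization_open_bigU.
End Realization.

(* euclidean_sphere n is the sphere of dimension n - 1 in R^n. It is empty for
   n = 0. The library's norm on row vectors is the sup norm, hence the sums of
   squares. *)
Definition euclidean_sphere (R : realType) (n : nat) : set 'rV[R]_n :=
  [set v | \sum_(i < n) v ord0 i ^+ 2 = 1].

Definition euclidean_ball (R : realType) (n : nat) : set 'rV[R]_n :=
  [set v | \sum_(i < n) v ord0 i ^+ 2 <= 1].

Arguments euclidean_sphere : clear implicits.
Arguments euclidean_ball : clear implicits.

(* n stands for m + 1, where m >= -1 is the dimension of the sphere. *)
Definition k_connected (R : realType) (X : topologicalType) (k : int) : Prop :=
  forall n : nat, n%:Z - 1 <= k ->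
  forall f : euclidean_sphere R n -> X, continuous f ->
  exists2 g : euclidean_ball R n -> X, continuous g &
    forall (u : euclidean_ball R n) (v : euclidean_sphere R n),
      \val u = \val v -> g u = f v.

(* conn(X) = k *)
Definition has_connectivity (R : realType) (X : topologicalType) (k : int) :
    Prop :=
  k_connected R X k /\ forall l : int, k_connected R X l -> l <= k.

Definition homotopic (R : realType) (X Y : topologicalType) (f g : X -> Y) :
    Prop :=
  exists F : X * R -> Y,
    [/\ {within [set: X] `*` `[0, 1], continuous F},
        forall a, F (a, 0) = f a & forall a, F (a, 1) = g a].

Definition homotopy_equivalent (R : realType) (X Y : topologicalType) : Prop :=
  exists (f : X -> Y) (g : Y -> X),
    [/\ continuous f, continuous g,
        homotopic R (g \o f) idfun & homotopic R (f \o g) idfun].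

Section Wedge3.
Context (X Y Z : topologicalType) (a : X) (b : Y) (c : Z).

Definition space3 (n : nat) : topologicalType :=
  match n with 0 => X | 1 => Y | _ => Z end.

Definition point3 (n : nat) : space3 n :=
  match n with 0 => a | 1 => b | _ => c end.

Definition wedge3 : topologicalType :=
  wedge (fun i : 'I_3 => point3 i).
End Wedge3.

(* Main.v *)
Require Import Defs.
From mathcomp Require Import all_boot all_order all_algebra finmap.
From mathcomp Require Import all_classical reals topology normedtype homotopy.
From mathcomp Require Import realfun lra.
Import Order.TTheory GRing.Theory Num.Theory numFieldNormedType.Exports.

Set Implicit Arguments.
Unset Strict Implicit.
Unset Printing Implicit Defensive.

Local Open Scope classical_set_scope.
Local Open Scope ring_scope.

(** Write A, B and X for the realizations of the neighborhood complexes of H, K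
and of the join. Sorted by a common neighbor of their vertices, the simplices
for the join are those for H and K, those of the cone with apex z over the
(possibly infinite) full simplex of neighbors of x in H, those of the cone with
apex z over the neighbors of y in K, and the edge xy, whose vertices have the
common neighbor z. A cone over a full simplex is as good as one edge from its
apex: choose a neighbor h of x and a neighbor k of y. Then X is, up to
homotopy, A and B joined by two arcs, the arc h - z - k and the edge xy. In a
connected non-bipartite graph any two vertices are joined by a walk of even
length, and the vertices at even positions of a walk form a path in the
neighborhood complex; so A and B are path connected, the ends of both arcs can
be moved to the base points p and q, the first arc can be contracted, and the
second one becomes a circle.

The maps and homotopies are explicit. [join_elim] builds a map on X from maps on
A and B and two paths, already including the collapse of the two cones, and
[wedge_circle_elim] builds a map on the wedge from maps on A and B and a closed
path. A homotopy is obtained by giving these data a parameter, and is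
continuous by [continuous_join_elim] and [continuous_wedge_elim]. The coherent
topology and the quotient topology stay final after a product with the line,
because closed intervals are compact ([continuous_final_prod]).

[to_wedge] sends the two arcs to paths through the base point, the second one
going once around the circle. [from_wedge] is the inclusion on A; on B it must
send q to p, so a neighborhood of q is stretched along a path from q to p
through the first arc. This uses that every point of a realization, vertex or
not, has a neighborhood that contracts to it ([well_pointed]). Both composites
are then deformed to the identity. Every path that has to be straightened goes
back and forth along a path defined on the whole line: it is a reparametrization
of that path, and interpolating linearly between two reparametrizations with
the same ends is the homotopy needed.

For the connectivity, X is path connected since the join is again connected and
not bipartite. It is not 1-connected because the circle is a retract of the
wedge, and the identity of the circle is not homotopic to a constant
([no_contraction]). For that, regard the circle as the unit complex numbers:
whether a self-map is the square of a continuous map does not change under a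
homotopy; a constant is a square, but if h(u)^2 = u, then h(-u) times the
conjugate of h(u) squares to -1, so its imaginary part is continuous, odd and
never 0, which is impossible. *)

(** * Continuity and products with the line *)

Section Continuity.
Context {R : realType}.

Lemma continuous_compose {T Y Z : topologicalType} (f : T -> Y) (g : Y -> Z) :
  continuous f -> continuous g -> continuous (fun t => g (f t)).
Proof. by move=> cf cg t; apply: continuous_comp; [exact: cf|exact: cg]. Qed.

Lemma continuous_pair {T Y Z : topologicalType} (f : T -> Y) (g : T -> Z) :
  continuous f -> continuous g -> continuous (fun t => (f t, g t)).
Proof. by move=> cf cg t; apply: cvg_pair; [exact: cf|exact: cg]. Qed.

Lemma continuous_ext {T Y : topologicalType} (f g : T -> Y) :
  f =1 g -> continuous f -> continuous g.
Proof. by move=> /funext ->. Qed.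

Lemma continuous_fst {T Y : topologicalType} : continuous (fst : T * Y -> T).
Proof. by move=> [t y]; exact: cvg_fst. Qed.

Lemma continuous_snd {T Y : topologicalType} : continuous (snd : T * Y -> Y).
Proof. by move=> [t y]; exact: cvg_snd. Qed.

Lemma continuous_const {T Y : topologicalType} (y : Y) : continuous
  (fun _ : T => y).
Proof. by move=> t; exact: cvg_cst. Qed.

Lemma continuous_ident {T : topologicalType} : continuous (fun t : T => t).
Proof. by move=> t; exact: cvg_id. Qed.

Lemma continuous_add {T : topologicalType} (f g : T -> R) :
  continuous f -> continuous g -> continuous (fun t => f t + g t).
Proof. by move=> cf cg t; apply: (@cvgD _ R^o); [exact: cf|exact: cg]. Qed.

Lemma continuous_opp {T : topologicalType} (f : T -> R) :
  continuous f -> continuous (fun t => - f t).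
Proof. by move=> cf t; apply: (@cvgN _ R^o); exact: cf. Qed.

Lemma continuous_mul {T : topologicalType} (f g : T -> R) :
  continuous f -> continuous g -> continuous (fun t => f t * g t).
Proof. by move=> cf cg t; apply: cvgM; [exact: cf|exact: cg]. Qed.

Lemma continuous_minr {T : topologicalType} (f g : T -> R) :
  continuous f -> continuous g -> continuous (fun t => Num.min (f t) (g t)).
Proof. by move=> cf cg t; apply: continuous_min; [exact: cf|exact: cg]. Qed.

Lemma continuous_maxr {T : topologicalType} (f g : T -> R) :
  continuous f -> continuous g -> continuous (fun t => Num.max (f t) (g t)).
Proof. by move=> cf cg t; apply: continuous_max; [exact: cf|exact: cg]. Qed.

(** Pasting along two closed sets. Both branches are continuous everywhere,
which keeps subspaces out of all later constructions; this is why paths and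
homotopies below are defined on the whole line. *)
Lemma continuous_if {T Y : topologicalType} (c d : T -> R) (f g : T -> Y) :
    continuous c -> continuous d -> continuous f -> continuous g ->
    (forall t, c t = d t -> f t = g t) ->
  continuous (fun t => if c t <= d t then f t else g t).
Proof.
move=> cc cd cf cg fg t U.
have lt_near (a b : T -> R) : continuous a -> continuous b ->
    a t < b t -> \forall t' \near t, a t' < b t'.
  move=> ca cb ab.
  have cba : continuous (fun t => b t + - a t).
    by apply: continuous_add => //; exact: continuous_opp.
  have : \forall t' \near t, 0 < b t' + - a t'.
    by apply: (cba t [set x | 0 < x]); apply: lt_nbhsr; rewrite subr_gt0.
  by apply: filterS => t'; rewrite subr_gt0.
move=> FU.
suff: \forall t' \near t, U (if c t' <= d t' then f t' else g t') by [].
move: FU; have [cdlt|dclt|cdt] := ltgtP (c t) (d t) => FU.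
- have {}FU : \forall t' \near t, U (f t') by exact: cf.
  apply: filter_app FU; apply: filter_app (lt_near _ _ cc cd cdlt).
  by apply: nearW => t' /ltW cdt' Uf; rewrite cdt'.
- have {}FU : \forall t' \near t, U (g t') by exact: cg.
  apply: filter_app FU; apply: filter_app (lt_near _ _ cd cc dclt).
  by apply: nearW => t' + Ug; rewrite ltNge => /negbTE cdt'; rewrite cdt'.
have GU : \forall t' \near t, U (g t') by apply: cg; rewrite -fg.
have {}FU : \forall t' \near t, U (f t') by exact: cf.
apply: filter_app FU; apply: filter_app GU.
by apply: nearW => t' Ug Uf; case: ifP.
Qed.


Lemma compact_tube {T : topologicalType} (J : set R) (O : set (T * R)) (a : T) :
    compact J -> open O -> (forall t, J t -> O (a, t)) ->
  \forall b \near a, forall t, J t -> O (b, t).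
Proof.
move=> /compact_near_coveringP cJ oO aJO.
apply: (cJ T (nbhs a) (fun b t => O (b, t))) => t Jt.
have : nbhs (a, t) O by apply: open_nbhs_nbhs; split => //; exact: aJO.
case=> -[A B] /= [aA tB] AB; exists (B, A) => //= -[t' b] /= [Bt' Ab].
exact: (AB (b, t')).
Qed.

(** A product of a final family of maps with the line is again final: near (a,
t) the set of b with F (b, t') in O for all t' in a closed interval around t
is open, since by the tube lemma its inverse images are. *)
Lemma continuous_final_prod {I : Type} {S : I -> topologicalType}
    {X Y : topologicalType}
    (q : forall i, S i -> X) (F : X * R -> Y) :
    (forall U : set X, (forall i, open (q i @^-1` U)) -> open U) ->
    (forall a, exists i b, q i b = a) ->
    (forall i, continuous (fun z : S i * R => F (q i z.1, z.2))) ->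
  continuous F.
Proof.
move=> finq surjq cF [a t] U.
rewrite nbhsE => -[O [oO OFat] OU].
suff FO : nbhs (a, t) (F @^-1` O) by apply: filterS FO => z /OU.
have [i [b qb]] := surjq a.
have : \forall t' \near t, O (F (a, t')).
  have cFa : continuous (fun t' : R => F (a, t')).
    rewrite -qb; apply: (@continuous_compose _ _ _
      (fun t' : R => (b, t')) (fun z => F (q i z.1, z.2))); last exact: cF.
    by apply: continuous_pair;
      [exact: continuous_const|exact: continuous_ident].
  by apply: (cFa t); apply: open_nbhs_nbhs; split.
move=> /nbhs_ballP[e /= e0 te].
pose J := `[t - e / 2, t + e / 2]%classic.
have JO t' : J t' -> O (F (a, t')).
  rewrite /J /= in_itv /= => /andP[t't tt']; apply: te.
  by rewrite /ball /= ltr_norml; apply/andP; split; lra.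
(* The open set required is the product of V with the interior of J. *)
pose V := [set b' : X | forall t', J t' -> O (F (b', t'))].
have oV : open V.
  apply: finq => j; rewrite openE => b' /= Vb'.
  have oFO : open [set z : S j * R | O (F (q j z.1, z.2))].
    by apply: open_comp => // z _; exact: cF.
  have := compact_tube (@segment_compact R (t - e / 2) (t + e / 2)) oFO Vb'.
  exact.
exists (V, J) => /=; last by move=> -[b' t'] /= [Vb' Jt']; exact: Vb'.
split; first by apply: open_nbhs_nbhs; split.
apply/nbhs_ballP; exists (e / 2) => /=; first by rewrite divr_gt0.
move=> t'; rewrite /ball /= ltr_norml /J /= in_itv /= => /andP[? ?].
by apply/andP; split; lra.
Qed.

End Continuity.

(** * Points and maps of a geometric realization *)

Section Realization.
Context {R : realType}.

Lemma continuous_into_prod {T : topologicalType} {I : choiceType}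
    (f : T -> prod_topology (fun _ : I => R)) :
  (forall i, continuous (fun t => f t i)) -> continuous f.
Proof.
move=> cf t; apply/cvg_sup => i U [_ [[O oO <-] Oft OU]].
by apply: filterS OU _; apply: (cf i t); exact: open_nbhs_nbhs.
Qed.

Section OneComplex.
Context {V : choiceType} {K : simplicial_complex V}.
Implicit Types (a b p : realization R K) (s : {fset V}).

Lemma barycentric_inj a b :
  (forall v, barycentric a v = barycentric b v) -> a = b.
Proof. by move=> ab; apply: val_inj; exact/funext. Qed.

Lemma carrier_simplex a :
  exists2 s, simplices K s & closed_simplex s (barycentric a).
Proof. by have := set_mem (valP a) => -[s Ks sa]; exists s. Qed.

(** Reading coordinates as a point of the realization, with [p] as the value
on coordinates that are not those of a point. *)
Definition realize p (f : V -> R) : realization R K :=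
  if pselect ((\bigcup_(s in simplices K) @closed_simplex R V s) f) is left Kf
  then exist _ f (mem_set Kf) else p.

Lemma realizeK p s f : simplices K s -> closed_simplex s f ->
  barycentric (realize p f) = f.
Proof.
move=> Ks sf; rewrite /realize; case: pselect => //.
by case; exists s.
Qed.

Section SimplexInclusion.
Context (s : {fset V}) (Ks : simplices K s).

Definition simplex_incl (b : @closed_simplex R V s) : realization R K :=
  exist _ (\val b) (mem_set
    (ex_intro2 _ _ s Ks (set_mem (valP b)) :
      (\bigcup_(s in simplices K) closed_simplex s) (\val b))).

Lemma simplex_incl_preimage_open (U : set (realization R K)) :
  open (@barycentric R V K @` U : set (subspace (closed_simplex s))) <->
  open (simplex_incl @^-1` U).
Proof.
split=> [/open_subspaceP[O oO OU]|[O oO OU]].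
  exists O => //; apply/seteqP; split=> b /=.
    move=> Ob; have : (O `&` closed_simplex s) (\val b).
      by split=> //; exact: set_mem (valP b).
    rewrite OU => -[[a Ua ab] _].
    by have -> : simplex_incl b = a by apply: val_inj.
  move=> Ub; have : (@barycentric R V K @` U `&` closed_simplex s) (\val b).
    by split; [exists (simplex_incl b)|exact: set_mem (valP b)].
  by rewrite -OU => -[].
apply/open_subspaceP; exists O => //.
apply/seteqP; split=> f [+ sf].
  move=> Of; split=> //; pose b : closed_simplex s := exist _ f (mem_set sf).
  have : (simplex_incl @^-1` U) b by rewrite -OU.
  by exists (simplex_incl b).
move=> [a Ua af]; split=> //.
pose b : closed_simplex s := exist _ f (mem_set sf).
suff : (\val @^-1` O) b by [].
rewrite OU /=; suff -> : simplex_incl b = a by [].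
by apply: val_inj; rewrite /= -af.
Qed.

Lemma simplex_incl_continuous : continuous simplex_incl.
Proof.
apply/continuousP => U oU; apply/simplex_incl_preimage_open; exact: oU.
Qed.

End SimplexInclusion.

Lemma open_realizationP (U : set (realization R K)) :
  (forall s (Ks : simplices K s), open (simplex_incl Ks @^-1` U)) -> open U.
Proof.
move=> oU; suff: realization_open U by [].
by move=> s Ks; apply/(simplex_incl_preimage_open Ks); exact: oU.
Qed.

(** On a single closed simplex the topology is that of the coordinates; for a
map into a whole infinite complex continuous coordinates would not suffice. *)
Lemma continuous_into_simplex {T : topologicalType} (f : T -> realization R K)
    s :
    simplices K s -> (forall t, closed_simplex s (barycentric (f t))) ->
    (forall v, continuous (fun t => barycentric (f t) v)) ->
  continuous f.
Proof.
move=> Ks sf cf.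
pose g (t : T) : closed_simplex s := exist _ (barycentric (f t))
  (mem_set (sf t)).
have -> : f = simplex_incl Ks \o g.
  by apply/funext => t; exact: val_inj.
move=> t; apply: continuous_comp; last exact: simplex_incl_continuous.
move: t; apply: continuous_comp_initial.
exact: continuous_into_prod.
Qed.

Lemma continuous_from_simplices {Y : topologicalType}
    (F : realization R K -> Y) :
    (forall (T : topologicalType) (i : T -> realization R K) s,
      simplices K s -> continuous i ->
      (forall t, closed_simplex s (barycentric (i t))) ->
      continuous (fun t => F (i t))) ->
  continuous F.
Proof.
move=> cF; apply/continuousP => U oU; apply: open_realizationP => s Ks.
move: U oU; apply/continuousP; apply: (cF _ _ s Ks).
  exact: simplex_incl_continuous.
by move=> t; exact: set_mem (valP t).
Qed.

(** A closed simplex enters as an arbitrary map [i] into it, so that the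
product with the line can be handled by composing continuous maps. *)
Lemma continuous_prod_from_simplices {Y : topologicalType}
    (F : realization R K * R -> Y) :
    (forall (T : topologicalType) (i : T -> realization R K) s,
      simplices K s -> continuous i ->
      (forall t, closed_simplex s (barycentric (i t))) ->
      continuous (fun z : T * R => F (i z.1, z.2))) ->
  continuous F.
Proof.
move=> cF.
pose q (s : {s | simplices K s}) := @simplex_incl _ (proj2_sig s).
apply: (@continuous_final_prod R _ _ _ _ q F).
- move=> U oU; apply: open_realizationP => s Ks.
  exact: (oU (exist _ s Ks)).
- move=> a; have [s Ks sa] := carrier_simplex a.
  exists (exist _ s Ks), (exist _ (barycentric a) (mem_set sa)).
  exact: val_inj.
move=> [s Ks]; apply: (cF _ _ s Ks) => /=; first exact: simplex_incl_continuous.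
by move=> t; exact: set_mem (valP t).
Qed.

Lemma continuous_coord v :
  continuous (fun a : realization R K => barycentric a v).
Proof.
apply/continuousP => U oU; apply: open_realizationP => s Ks.
move: U oU; apply/continuousP => b.
apply: (@continuous_comp _ _ _ (\val : closed_simplex s -> _) (@proj _ _ v)).
  exact: initial_continuous.
exact: proj_continuous.
Qed.

Lemma coord_itv a v : 0 <= barycentric a v <= 1.
Proof.
have [s _ [a0 a_s a1]] := carrier_simplex a; rewrite a0 -a1 /=.
have [vs|vs] := boolP (v \in s); last by rewrite a_s // sumr_ge0.
rewrite (bigD1_seq v) ?fset_uniq //=; apply: ler_wpDr => //.
by apply: sumr_ge0 => w _; exact: a0.
Qed.

End OneComplex.

Section ClosedSimplex.
Context {V : choiceType}.
Implicit Types (a b : V -> R) (s t : {fset V}).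

(** Only the support matters, not the simplex used to exhibit a point. *)
Lemma closed_simplex_support s t a :
    closed_simplex s a -> (forall v, v \notin t -> a v = 0) ->
  closed_simplex t a.
Proof.
move=> [a0 a_s a1] a_t; split => //; rewrite -a1.
rewrite (@big_fset_incl _ _ _ _ t (s `|` t)%fset a) ?fsubsetUr //; last first.
  by move=> v _; exact: a_t.
rewrite (@big_fset_incl _ _ _ _ s (s `|` t)%fset a) ?fsubsetUl //.
by move=> v _; exact: a_s.
Qed.

Lemma closed_simplexS s t a :
  (s `<=` t)%fset -> closed_simplex s a -> closed_simplex t a.
Proof.
move=> /fsubsetP st sa; apply: (closed_simplex_support sa) => v vt.
by case: sa => _ -> //; apply: contra vt; exact: st.
Qed.

Definition segment_point a b (c : R) : V -> R :=
  fun v => (1 - c) * a v + c * b v.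

Lemma closed_simplex_convex s a b c : 0 <= c <= 1 ->
  closed_simplex s a -> closed_simplex s b ->
  closed_simplex s (segment_point a b c).
Proof.
move=> /andP[c0 c1] [a0 a_s a1] [b0 b_s b1]; rewrite /segment_point; split.
- by move=> v; rewrite addr_ge0 // mulr_ge0 // subr_ge0.
- by move=> v vs; rewrite a_s // b_s // !mulr0 addr0.
- by rewrite big_split /= -!mulr_sumr a1 b1; lra.
Qed.

Definition vertex_coord (u : V) : V -> R := fun v => (v == u)%:R.

Lemma closed_simplex_vertex s u : u \in s -> closed_simplex s (vertex_coord u).
Proof.
move=> us; rewrite /vertex_coord; split.
- by move=> v; exact: ler0n.
- by move=> v; case: eqP => [->|//]; rewrite us.
rewrite (bigD1_seq u) //= eqxx big1 ?addr0 // => v /negbTE vu.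
by rewrite vu.
Qed.

End ClosedSimplex.
End Realization.

(** * Homotopies, segments and neighborhoods of a base point *)

(** Continuity of polynomial expressions, minima, maxima and pairs, by the
head symbol of the function. *)
Ltac contin := repeat lazymatch goal with
  | |- continuous (fun _ => ?c) => exact: continuous_const
  | |- continuous (fun t => t) => exact: continuous_ident
  | |- continuous (fun t => fst t) => exact: continuous_fst
  | |- continuous (fun t => snd t) => exact: continuous_snd
  | |- continuous (fun t => barycentric t _) => exact: continuous_coord
  | |- continuous (fun t => (@?f t + @?g t)%R) => apply: continuous_add
  | |- continuous (fun t => (- @?f t)%R) => apply: continuous_opp
  | |- continuous (fun t => (@?f t * @?g t)%R) => apply: continuous_mul
  | |- continuous (fun t => (@?f t ^+ 2)%R) => apply: continuous_mul
  | |- continuous (fun t => Num.min (@?f t) (@?g t)) => apply: continuous_minr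
  | |- continuous (fun t => Num.max (@?f t) (@?g t)) => apply: continuous_maxr
  | |- continuous (fun t => (@?f t, @?g t)) => apply: continuous_pair
  | |- continuous (Num.min _) => apply: continuous_minr
  | |- continuous (Num.max _) => apply: continuous_maxr
  | |- continuous ( +%R _) => apply: continuous_add
  | |- continuous ( *%R _) => apply: continuous_mul
  | |- continuous -%R => apply: continuous_opp
  | |- continuous fst => exact: continuous_fst
  | |- continuous snd => exact: continuous_snd
  | |- continuous _ => assumption
  end.

Section Homotopy.
Context {R : realType}.

Definition clamp (t : R) : R := Num.max 0 (Num.min 1 t).

Lemma clamp_itv t : 0 <= clamp t <= 1.
Proof. by rewrite /clamp le_max lexx /= ge_max ler01 /= ge_min lexx. Qed.

Lemma clamp_id t : 0 <= t <= 1 -> clamp t = t.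
Proof. by case/andP => t0 t1; rewrite /clamp min_r // max_r. Qed.

Lemma clamp0 : clamp 0 = 0. Proof. by rewrite clamp_id // lexx ler01. Qed.
Lemma clamp1 : clamp 1 = 1. Proof. by rewrite clamp_id // lexx ler01. Qed.

Lemma continuous_clamp : continuous clamp.
Proof. by rewrite /clamp; contin. Qed.

(** Homotopies with parameter in the whole line can be reparametrized and
pasted without restricting to [0, 1]; [homot_homotopic] forgets the excess. *)
Definition homot {X Y : topologicalType} (f g : X -> Y) : Prop :=
  exists F : X * R -> Y, [/\ continuous F,
    forall a, F (a, 0) = f a & forall a, F (a, 1) = g a].

Lemma homot_homotopic {X Y : topologicalType} (f g : X -> Y) :
  homot f g -> homotopic R f g.
Proof.
by move=> [F [cF F0 F1]]; exists F; split => //; exact: continuous_subspaceT.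
Qed.

Lemma homot_trans {X Y : topologicalType} (f g h : X -> Y) :
  homot f g -> homot g h -> homot f h.
Proof.
move=> [F [cF F0 F1]] [G [cG G0 G1]].
exists (fun z => if z.2 <= 1 / 2 then F (z.1, 2 * z.2) else
                 G (z.1, 2 * z.2 - 1)); split => /=.
- apply: continuous_if; contin.
  + by apply: continuous_compose cF; contin.
  + by apply: continuous_compose cG; contin.
  + move=> [a t] /= ->; have -> : 2 * (1 / 2) = 1 :> R by lra.
    by rewrite subrr F1 G0.
- by move=> a; rewrite ifT ?mulr0 ?F0 //; lra.
- move=> a; rewrite ifF ?mulr1; last by apply/negbTE; rewrite -ltNge; lra.
  by have -> : 2 - 1 = 1 :> R by lra.
Qed.

Lemma homot_sym {X Y : topologicalType} (f g : X -> Y) : homot f g -> homot g f.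
Proof.
move=> [F [cF F0 F1]]; exists (fun z => F (z.1, 1 - z.2)); split => /=.
- by apply: continuous_compose cF; contin.
- by move=> a; rewrite subr0.
- by move=> a; rewrite subrr.
Qed.

Definition path_joined {X : topologicalType} (a b : X) : Prop :=
  exists g : R -> X, [/\ continuous g, g 0 = a & g 1 = b].

Lemma path_joined_sym {X : topologicalType} (a b : X) :
  path_joined a b -> path_joined b a.
Proof.
move=> [g [cg g0 g1]]; exists (fun t => g (1 - t)); split; first 1 last.
- by rewrite subr0.
- by rewrite subrr.
- by apply: continuous_compose cg; contin.
Qed.

Lemma path_joined_trans {X : topologicalType} (a b c : X) :
  path_joined a b -> path_joined b c -> path_joined a c.
Proof.
move=> [g [cg g0 g1]] [h [ch h0 h1]].
exists (fun t => if t <= 1 / 2 then g (2 * t) else h (2 * t - 1)); split.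
- apply: continuous_if; contin.
  + by apply: continuous_compose cg; contin.
  + by apply: continuous_compose ch; contin.
  + move=> t ->; have -> : 2 * (1 / 2) = 1 :> R by lra.
    by rewrite subrr g1 h0.
- by rewrite ifT ?mulr0 //; lra.
- rewrite ifF ?mulr1; last by apply/negbTE; rewrite -ltNge; lra.
  by have -> : 2 - 1 = 1 :> R by lra.
Qed.

Section Complex.
Context {V : choiceType} {K : simplicial_complex V}.
Implicit Types (a b p : realization R K) (s : {fset V}).

Lemma segment_point0 a b : segment_point (barycentric a) (barycentric b) 0 =
  barycentric a.
Proof. by apply/funext => v; rewrite /segment_point; lra. Qed.

Lemma segment_point1 a b : segment_point (barycentric a) (barycentric b) 1 =
  barycentric b.
Proof. by apply/funext => v; rewrite /segment_point; lra. Qed.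

Lemma realize_barycentric p a : realize p (barycentric a) = a.
Proof.
have [s Ks sa] := carrier_simplex a.
by apply: val_inj; exact: (realizeK p Ks sa).
Qed.

Definition segment a b (c : R) : realization R K :=
  realize a (segment_point (barycentric a) (barycentric b) (clamp c)).

Lemma segment0 a b : segment a b 0 = a.
Proof. by rewrite /segment clamp0 segment_point0 realize_barycentric. Qed.

Lemma segment1 a b : segment a b 1 = b.
Proof. by rewrite /segment clamp1 segment_point1 realize_barycentric. Qed.

Lemma segment_same a c : segment a a c = a.
Proof.
rewrite /segment -[RHS](realize_barycentric a); congr realize.
by apply/funext => v; rewrite /segment_point; lra.
Qed.

Lemma continuous_segment {T : topologicalType} (f g : T -> realization R K)
    (c : T -> R) s :
    simplices K s -> continuous f -> continuous g -> continuous c ->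
    (forall t, closed_simplex s (barycentric (f t))) ->
    (forall t, closed_simplex s (barycentric (g t))) ->
  continuous (fun t => segment (f t) (g t) (c t)).
Proof.
move=> Ks cf cg cc sf sg.
have sfg t : closed_simplex s
    (segment_point (barycentric (f t)) (barycentric (g t)) (clamp (c t))).
  by apply: closed_simplex_convex => //; exact: clamp_itv.
apply: (continuous_into_simplex Ks) => [t|v].
  by rewrite /segment (realizeK _ Ks).
rewrite (_ : (fun t => _) = fun t => segment_point (barycentric (f t))
  (barycentric (g t)) (clamp (c t)) v); last first.
  by apply/funext => t; rewrite /segment (realizeK _ Ks).
have cclamp : continuous (fun t => clamp (c t)).
  exact: continuous_compose cc continuous_clamp.
have cfv : continuous (fun t => barycentric (f t) v).
  exact: (continuous_compose cf (@continuous_coord _ _ _ v)).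
have cgv : continuous (fun t => barycentric (g t) v).
  exact: (continuous_compose cg (@continuous_coord _ _ _ v)).
by rewrite /segment_point; contin.
Qed.

(** The straight-line homotopy. Its continuity for the coherent topology needs
that each closed simplex is sent into one closed simplex by both maps. *)
Lemma homot_segment {U : choiceType} {L : simplicial_complex U}
    (f g : realization R L -> realization R K) :
    continuous f -> continuous g ->
    (forall s : {fset U}, simplices L s -> exists2 s', simplices K s' &
      forall a : realization R L, closed_simplex s (barycentric a) ->
        closed_simplex s' (barycentric (f a)) /\
        closed_simplex s' (barycentric (g a))) ->
  homot f g.
Proof.
move=> cf cg fg; exists (fun z => segment (f z.1) (g z.1) z.2); split => /=.
- apply: continuous_prod_from_simplices => T i s Ls ci si.
  have [s' Ks' s'P] := fg _ Ls.
  apply: (continuous_segment Ks') => /=; contin.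
  + apply: (continuous_compose _ cf); apply: continuous_compose ci; contin.
  + apply: (continuous_compose _ cg); apply: continuous_compose ci; contin.
  + by move=> z; have [] := s'P _ (si z.1).
  + by move=> z; have [] := s'P _ (si z.1).
- by move=> a; exact: segment0.
- by move=> a; exact: segment1.
Qed.

(** The largest c in [0, 1] for which c times the coordinates of [p] is below
those of [a], when [vs] is the support of [p]. *)
Definition min_ratio p (vs : seq V) a : R :=
  foldr (fun v m => Num.min (barycentric a v / barycentric p v) m) 1 vs.

Lemma continuous_min_ratio p vs : continuous (min_ratio p vs).
Proof.
elim: vs => [|v vs IH]; first exact: continuous_const.
by rewrite /min_ratio /= -/(min_ratio p vs); contin.
Qed.

Lemma min_ratio_le p vs a v : v \in vs ->
  min_ratio p vs a <= barycentric a v / barycentric p v.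
Proof.
elim: vs => //= w vs IH; rewrite inE => /predU1P[->|/IH le_vs].
  by rewrite ge_min lexx.
by rewrite ge_min le_vs orbT.
Qed.

Lemma min_ratio_self p vs : (forall v, v \in vs -> barycentric p v != 0) ->
  min_ratio p vs p = 1.
Proof.
elim: vs => //= v vs IH p0.
rewrite IH ?divff ?minxx ?p0 ?mem_head // => w wvs.
by rewrite p0 // inE wvs orbT.
Qed.

(** Near [p] every closed simplex of a point contains [p], so the points near
[p] can be moved to [p] along segments. How far a point moves is governed by
[lam], which vanishes outside the open star of [p], so that points of the
other simplices stay. *)
Lemma well_pointed p : exists (lam : realization R K -> R)
    (h : realization R K * R -> realization R K),
  [/\ continuous lam /\ continuous h, lam p = 1, forall a, h (a, 0) = a,
      forall a, 1 / 2 <= lam a -> h (a, 1) = p & forall t, h (p, t) = p].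
Proof.
have [s0 Ks0 [p0 ps0 _]] := carrier_simplex p.
pose vs := [seq v <- s0 | barycentric p v != 0].
pose lam := min_ratio p vs.
have clam : continuous lam by exact: continuous_min_ratio.
have lam_carrier a s : closed_simplex s (barycentric a) -> 0 < lam a ->
    closed_simplex s (barycentric p).
  move=> [_ as0 _] lam0; have [s1 _ p1] := carrier_simplex p.
  apply: (closed_simplex_support p1) => v vs'.
  apply/eqP; apply: contraTT lam0 => pv; rewrite -leNgt.
  have -> : 0 = barycentric a v / barycentric p v :> R by rewrite as0 // mul0r.
  apply: min_ratio_le; rewrite mem_filter pv /=.
  by apply: contraNT pv => /ps0 ->.
exists lam.
exists (fun z => segment z.1 p
  (clamp z.2 * Num.max 0 (Num.min 1 (2 * lam z.1)))).
split => //.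
- split => //; apply: continuous_prod_from_simplices => T i s Ks ci si /=.
  have [[t0 lam0]|lam0] := pselect (exists t, 0 < lam (i t)).
    have sp := lam_carrier _ _ (si t0) lam0.
    apply: (continuous_segment Ks); contin.
    + by apply: continuous_compose ci; contin.
    + exact: (continuous_compose continuous_snd continuous_clamp).
    + by apply: (continuous_compose _ clam); apply: continuous_compose ci;
      contin.
    + by move=> z; exact: si.
    + by [].

  apply: (@continuous_ext _ _ (fun z : T * R => i z.1)) => [z|].
    rewrite max_l ?mulr0 ?segment0 //.
    rewrite ge_min; apply/orP; right.
    have : ~~ (0 < lam (i z.1)) by apply/negP => ?; apply: lam0; exists z.1.
    by rewrite -leNgt; lra.
  by apply: continuous_compose ci; contin.
- by apply: min_ratio_self => v; rewrite mem_filter => /andP[].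
- by move=> a /=; rewrite clamp0 mul0r segment0.
- move=> a lam12 /=; rewrite clamp1 mul1r.
  rewrite (@min_l _ _ 1) ?max_r ?segment1 //; lra.
- by move=> t /=; exact: segment_same.
Qed.

End Complex.
End Homotopy.

(** * Even walks and path connectedness *)

Section Walks.
Context {V : choiceType} (G : graph V).

Definition reach (b : bool) (u v : V) : Prop :=
  exists p, [/\ path G u p, last u p = v & odd (size p) = b].

Lemma reach_edge u v : G u v -> reach true u v.
Proof. by move=> uv; exists [:: v]; rewrite /= uv. Qed.

Lemma reach_trans b c u v w : reach b u v -> reach c v w -> reach (b (+) c) u w.
Proof.
move=> [p [up pv pb]] [q [vq qw qc]]; exists (p ++ q).
by rewrite cat_path last_cat size_cat oddD up pv vq qw pb qc.
Qed.

Lemma reach_sym b u v : reach b u v -> reach b v u.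
Proof.
move=> [p [up <- <-]]; elim: p u up => [|w p IH] u /=.
  by move=> _; exists [::].
case/andP => uw /IH; rewrite -addbT => wu; apply: reach_trans wu _.
by apply: reach_edge; rewrite adj_sym.
Qed.

Context (cG : connected_graph G) (nbG : ~ bipartite G).

(** Without an odd closed walk at [u], the parity of walks from [u] is a
proper 2-coloring. *)
Lemma reach_odd_closed u : reach true u u.
Proof.
apply: contrapT => nuu; apply: nbG; exists (fun v => `[< reach false u v >]).
move=> v w vw.
have even_or_odd v' : reach false u v' \/ reach true u v'.
  have [p up pv] := cG u v'.
  by case opp : (odd (size p)); [right|left]; exists p.
have close b c v' w' : G v' w' -> reach b u v' -> reach c u w' ->
    b (+) c = false -> False.
  move=> vw' uv uw bc; apply: nuu.
  have := reach_trans (reach_trans uv (reach_edge vw')) (reach_sym uw).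
  by rewrite addbAC bc.
apply/eqP; case: asboolP => [uv|nuv]; case: asboolP => [uw|nuw] // _.
  exact: (close _ _ _ _ vw uv uw).
have [//|uv] := even_or_odd v; have [//|uw] := even_or_odd w.
exact: (close _ _ _ _ vw uv uw).
Qed.

Lemma reach_any b u v : reach b u v.
Proof.
have [p up pv] := cG u v.
have uv : reach (odd (size p)) u v by exists p.
case opp : (odd (size p) == b); first by rewrite -(eqP opp).
have := reach_trans (reach_odd_closed u) uv.
by rewrite addTb; move: opp; case: (odd _); case: b.
Qed.

Lemma exists_neighbor u : exists v, G u v.
Proof.
have [[|v p] [//= /andP[uv _] _ _]] := reach_odd_closed u.
by exists v.
Qed.

End Walks.

Section PathConnected.
Context {R : realType}.

Lemma path_joined_simplex {V : choiceType} {K : simplicial_complex V}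
    (s : {fset V}) (a b : realization R K) :
    simplices K s -> closed_simplex s (barycentric a) ->
    closed_simplex s (barycentric b) -> path_joined (R := R) a b.
Proof.
move=> Ks sa sb; exists (fun t => segment a b t); rewrite segment0 segment1.
split => //.
apply: (continuous_segment Ks) => //.
- exact: continuous_const.
- exact: continuous_const.
- exact: continuous_ident.
Qed.

Context {V : choiceType} (G : graph V).
Let N := neighborhood_complex G.

Lemma neighborhood_simplex v (s : {fset V}) :
  (forall u, u \in s -> G u v) -> simplices N s.
Proof. by move=> sv; exists v. Qed.

Definition vertex (p : realization R N) (u : V) : realization R N :=
  realize p (vertex_coord u).

Lemma barycentric_vertex p u v : G u v ->
  barycentric (vertex p u) = vertex_coord u.
Proof.
move=> Guv; apply: (@realizeK _ _ _ _ [fset u]%fset).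
  by apply: (@neighborhood_simplex v) => w; rewrite inE => /eqP ->.
by apply: closed_simplex_vertex; rewrite inE.
Qed.

Lemma path_joined_vertices p u v w : G u w -> G v w ->
  path_joined (R := R) (vertex p u) (vertex p v).
Proof.
move=> uw vw; apply: (@path_joined_simplex _ N [fset u; v]%fset).
- by apply: (@neighborhood_simplex w) => x; rewrite !inE => /orP[] /eqP ->.
- rewrite (barycentric_vertex _ uw).
  by apply: closed_simplex_vertex; rewrite !inE eqxx.
- rewrite (barycentric_vertex _ vw).
  by apply: closed_simplex_vertex; rewrite !inE eqxx orbT.
Qed.

(** Two vertices with a common neighbor span an edge of the neighborhood
complex, so a walk is followed two steps at a time. The odd case is what the
induction on single steps needs. *)
Lemma path_joined_walk p u q : path G u q ->
  (~~ odd (size q) -> (exists v, G u v) ->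
    path_joined (R := R) (vertex p u) (vertex p (last u q))) /\
  (odd (size q) -> forall w, G u w ->
    path_joined (R := R) (vertex p w) (vertex p (last u q))).
Proof.
elim: q u => [|v q IH] u /=.
  move=> _; split => // _ [v uv]; exact: (path_joined_vertices p uv uv).
case/andP => uv /IH[IHeven IHodd]; rewrite negbK; split.
  by move=> oq _; apply: IHodd; rewrite // adj_sym.
move=> eq_ w uw; apply: (path_joined_trans (b := vertex p v)).
  by apply: (@path_joined_vertices p w v u); rewrite adj_sym.
by apply: IHeven => //; exists u; rewrite adj_sym.
Qed.

Lemma path_connected_neighborhood (a b : realization R N) :
  connected_graph G -> ~ bipartite G -> path_joined (R := R) a b.
Proof.
move=> cG nbG.
have to_vertex c : exists u, path_joined (R := R) c (vertex a u).
  have [s Ns sc] := carrier_simplex c.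
  have [u us] : exists u, u \in s.
    case: (fset_0Vmem s) => [s0|[u us]]; last by exists u.
    case: sc => _ _ /eqP; rewrite s0 big_nil.
    by rewrite eq_sym oner_eq0.
  exists u; apply: (path_joined_simplex Ns) => //.
  have [v vs] := Ns; rewrite (barycentric_vertex _ (vs _ us)).
  exact: closed_simplex_vertex.
have [u au] := to_vertex a; have [v bv] := to_vertex b.
apply: path_joined_trans au _; apply: path_joined_trans (path_joined_sym bv).
have [q [uq <- oq]] := reach_any cG nbG false u v.
have [+ _] := path_joined_walk a uq; rewrite oq; apply => //.
exact: exists_neighbor.
Qed.

End PathConnected.

(** * The part of the join on one side of the new vertex *)

Section Side.
Context {R : realType} {V W : choiceType} {H : graph V} {K : graph W}.
Context {x : V} {y : W}.
Let G := join_graph H K x y.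
Let X := realization R (neighborhood_complex G).

(** The two sides of the join play the same role. [e] embeds the graph [L],
attached to the new vertex at [u]; its retraction [e'] sends the new vertex to
the neighbor [n] of [u], which is the simplicial collapse of the cone onto its
base. *)
Record is_side {U : choiceType} (L : graph U) (u n : U)
    (e : U -> option (V + W)) (e' : option (V + W) -> U) : Prop := IsSide {
  side_can : cancel e e';
  side_neq : forall a, e a <> None;
  side_root : L u n;
  side_None : e' None = n;
  side_adj : forall a b, G (e a) (e b) = L a b;
  side_adj_None : forall a, G (e a) None = (a == u);
  side_adj_in : forall a c, G (e a) c -> c = None \/ exists b, c = e b }.

Context {U : choiceType} {L : graph U} {u n : U}.
Context {e : U -> option (V + W)} {e' : option (V + W) -> U}.
Context (side : is_side L u n e e').
Let A := realization R (neighborhood_complex L).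
Context (o : X) (p : A).

Definition on_side (c : option (V + W)) := (c == None) || (e (e' c) == c).

Lemma side_inj : injective e. Proof. exact: can_inj (side_can side). Qed.

Definition extend (f : U -> R) (c : option (V + W)) : R :=
  if e (e' c) == c then f (e' c) else 0.

Lemma extendE f a : extend f (e a) = f a.
Proof. by rewrite /extend (side_can side) eqxx. Qed.

Lemma extend_None f : extend f None = 0.
Proof. by rewrite /extend; case: eqP => // /(side_neq side). Qed.

Lemma closed_simplex_extend (s : {fset U}) f :
  closed_simplex s f -> closed_simplex (e @` s)%fset (extend f).
Proof.
move=> [f0 fs f1]; split.
- by move=> c; rewrite /extend; case: ifP.
- move=> c cs; rewrite /extend; case: eqP => // cc; apply: fs.
  by apply: contra cs => ?; rewrite -cc; exact: in_imfset.
rewrite big_imfset /=; last by move=> a b _ _; exact: side_inj.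
by rewrite -[RHS]f1; apply: eq_bigr => a _; rewrite extendE.
Qed.

Lemma simplex_extend (s : {fset U}) : simplices (neighborhood_complex L) s ->
  simplices (neighborhood_complex G) (e @` s)%fset.
Proof.
move=> [v sv]; apply: (@neighborhood_simplex _ G (e v)) => c.
by case/imfsetP => a as_ ->; rewrite (side_adj side); exact: sv.
Qed.

Definition side_incl (a : A) : X := realize o (extend (barycentric a)).

Lemma side_inclE a : barycentric (side_incl a) = extend (barycentric a).
Proof.
have [s Ls sa] := carrier_simplex a.
exact: realizeK (simplex_extend Ls) (closed_simplex_extend sa).
Qed.

Lemma continuous_side_incl : continuous side_incl.
Proof.
apply: continuous_from_simplices => T i s Ls ci si.
apply: (continuous_into_simplex (simplex_extend Ls)) => [t|c].
  by rewrite side_inclE; exact: closed_simplex_extend.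
apply: (@continuous_ext _ _ (fun t => extend (barycentric (i t)) c)) => [t|].
  by rewrite side_inclE.
rewrite /extend; case: (e (e' c) == c); last exact: continuous_const.
exact: (continuous_compose ci (@continuous_coord _ _ _ (e' c))).
Qed.

(** The coordinates of the image of a point under the simplicial map [e']. *)
Definition fold_coord (f : option (V + W) -> R) : U -> R :=
  fun a => f (e a) + (a == n)%:R * f None.

Lemma closed_simplex_fold (s : {fset option (V + W)}) f :
    (forall c, c \in s -> on_side c) -> closed_simplex s f ->
  closed_simplex (e' @` s)%fset (fold_coord f).
Proof.
move=> s_side sf; have [f0 fs f1] := sf; rewrite /fold_coord; split.
- by move=> a; rewrite addr_ge0 // mulr_ge0 // ler0n.
- move=> a as'; rewrite fs ?add0r; last first.
    apply: contra as' => eas; apply/imfsetP; exists (e a) => //=.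
    by rewrite (side_can side).
  case: eqP => [an|]; rewrite ?mul0r // mul1r fs //.
  apply: contra as' => Ns; apply/imfsetP; exists None => //=.
  by rewrite (side_None side).
have : closed_simplex (None |` (e @` (e' @` s)))%fset f.
  apply: (closed_simplex_support sf) => c; rewrite !inE negb_or => /andP[cN ce].
  apply: fs; apply: contra ce => cs; apply/imfsetP; exists (e' c) => /=.
    exact: in_imfset.
  by have := s_side _ cs; rewrite /on_side (negbTE cN) /= => /eqP.
case=> _ _; rewrite big_fsetU1 /=; last first.
  by apply/imfsetP => -[a _ /esym]; exact: (side_neq side).
rewrite big_imfset /=; last by move=> a b _ _; exact: side_inj.
move=> ft1; rewrite -[RHS]ft1 big_split /= addrC; congr (_ + _).
rewrite -mulr_suml; have [Ns|Ns] := boolP (None \in s); last first.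
  by rewrite fs // mulr0.
rewrite -[RHS]mul1r; congr (_ * _).
have : closed_simplex (e' @` s)%fset (vertex_coord n : U -> R).
  by apply: closed_simplex_vertex; rewrite -(side_None side); exact: in_imfset.
by case=> _ _ vn1; exact: vn1.
Qed.

(** A common neighbor of the folded simplex is found according to the common
neighbor c of the simplex: [n] if c is the new vertex, c itself if c is on the
side, and [u] if c is on the other side, for then the simplex is at most the
new vertex. *)
Lemma simplex_fold (s : {fset option (V + W)}) :
    (forall c, c \in s -> on_side c) -> simplices (neighborhood_complex G) s ->
  simplices (neighborhood_complex L) (e' @` s)%fset.
Proof.
move=> s_side [c sc].
have un := side_root side.
have [cN|cN] := eqVneq c None.
  subst c; apply: (@neighborhood_simplex _ L n) => _ /imfsetP[d /= ds ->].
  have := s_side _ ds; case/orP => /eqP dE.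
    by have := sc _ ds; rewrite dE adj_irr.
  by have := sc _ ds; rewrite -dE (side_adj_None side) (side_can side) =>
    /eqP ->.
have [[b cb]|nb] := pselect (exists b, c = e b).
  apply: (@neighborhood_simplex _ L b) => _ /imfsetP[d /= ds ->].
  have := s_side _ ds; case/orP => /eqP dE.
    have := sc _ ds; rewrite dE cb adj_sym (side_adj_None side) => /eqP ->.
    by rewrite (side_None side) adj_sym.
  by have := sc _ ds; rewrite cb -dE (side_adj side) (side_can side).
apply: (@neighborhood_simplex _ L u) => _ /imfsetP[d /= ds ->].
have := s_side _ ds; case/orP => /eqP dE.
  by rewrite dE (side_None side) adj_sym.
have := sc _ ds; rewrite -dE => /(side_adj_in side)[c0|cb].
  by rewrite c0 eqxx in cN.
by case: nb.
Qed.

Definition apex_half (a : X) : R := Num.min (barycentric a None) (1 / 2).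

(** The fold followed by a contraction to the vertex [n], which is completed
when the coordinate of the apex reaches 1/2. *)
Definition retract_coord (a : X) : U -> R :=
  segment_point (fold_coord (barycentric a)) (vertex_coord n) (2 * apex_half a).

Definition side_retract (a : X) : A := realize p (retract_coord a).

Lemma closed_simplex_retract (s : {fset option (V + W)}) (a : X) :
    (forall c, c \in s -> on_side c) -> closed_simplex s (barycentric a) ->
  closed_simplex (e' @` s)%fset (retract_coord a).
Proof.
move=> s_side sa.
have sfa := closed_simplex_fold s_side sa.
have [Ns|Ns] := boolP (None \in s).
  have [a0 a1] := andP (coord_itv a None).
  apply: closed_simplex_convex => //; rewrite /apex_half; last first.
    apply: closed_simplex_vertex; rewrite -(side_None side); exact: in_imfset.
  by case: (leP (barycentric a None)) => ?; apply/andP; split; lra.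
suff -> : retract_coord a = fold_coord (barycentric a) by [].
have [_ as0 _] := sa.
apply/funext => v; rewrite /retract_coord /apex_half as0 // min_l; last by lra.
by rewrite /segment_point; lra.
Qed.

Lemma side_retractE (s : {fset option (V + W)}) (a : X) :
    (forall c, c \in s -> on_side c) -> simplices (neighborhood_complex G) s ->
    closed_simplex s (barycentric a) ->
  barycentric (side_retract a) = retract_coord a.
Proof.
move=> s_side Ns sa; apply: (@realizeK _ _ _ _ (e' @` s)%fset).
  exact: simplex_fold.
exact: closed_simplex_retract.
Qed.

Lemma continuous_side_retract (T : topologicalType) (i : T -> X)
    (s : {fset option (V + W)}) :
    (forall c, c \in s -> on_side c) -> simplices (neighborhood_complex G) s ->
    continuous i -> (forall t, closed_simplex s (barycentric (i t))) ->
  continuous (fun t => side_retract (i t)).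
Proof.
move=> s_side Ns ci si.
apply: (continuous_into_simplex (simplex_fold s_side Ns)) => [t|v].
  by rewrite (side_retractE s_side Ns) //; exact: closed_simplex_retract.
apply: (@continuous_ext _ _ (fun t => retract_coord (i t) v)) => [t|].
  by rewrite (side_retractE s_side Ns).
have cc c : continuous (fun t => barycentric (i t) c).
  exact: (continuous_compose ci (@continuous_coord _ _ _ c)).
by rewrite /retract_coord /segment_point /fold_coord /apex_half; contin;
  apply: cc.
Qed.

Lemma side_retract_incl a : side_retract (side_incl a) = a.
Proof.
rewrite /side_retract -[RHS](realize_barycentric p); congr realize.
apply/funext => v; rewrite /retract_coord /apex_half /fold_coord side_inclE.
rewrite /segment_point extend_None extendE min_l; last by lra.
by lra.
Qed.

Lemma side_retract_far (a : X) : 1 / 2 <= barycentric a None ->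
  side_retract a = vertex p n.
Proof.
move=> a12; rewrite /side_retract /vertex; congr realize.
apply/funext => v; rewrite /retract_coord /apex_half min_r // /segment_point.
by lra.
Qed.

(** A map on one side with its cone: the half of the cone close to its base is
retracted to the base, and the half close to the apex is read as a path that
leaves the base at [n]. *)
Definition arm {Y : Type} (phi : A -> Y) (w : R -> Y) (a : X) : Y :=
  if barycentric a None <= 1 / 2 then phi (side_retract a)
  else w (barycentric a None - 1 / 2).

Lemma arm_incl {Y : Type} (phi : A -> Y) (w : R -> Y) a :
  arm phi w (side_incl a) = phi a.
Proof.
rewrite /arm side_inclE extend_None ifT ?side_retract_incl //; lra.
Qed.

Lemma continuous_arm {Y : topologicalType} (phi : R -> A -> Y)
    (w : R -> R -> Y) (T : topologicalType) (i : T -> X)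
    (s : {fset option (V + W)}) :
    continuous (fun z : A * R => phi z.2 z.1) ->
    continuous (fun z : R * R => w z.2 z.1) ->
    (forall t, phi t (vertex p n) = w t 0) ->
    (forall c, c \in s -> on_side c) -> simplices (neighborhood_complex G) s ->
    continuous i -> (forall t, closed_simplex s (barycentric (i t))) ->
  continuous (fun z : T * R => arm (phi z.2) (w z.2) (i z.1)).
Proof.
move=> cphi cw phiw s_side Ns ci si; rewrite /arm.
have cN : continuous (fun z : T * R => barycentric (i z.1) None).
  apply: (@continuous_compose _ _ _ (fun z : T * R => i z.1)
    (fun a : X => barycentric a None)).
    by apply: continuous_compose ci; contin.
  by contin.
apply: continuous_if; contin.
- apply: (@continuous_compose _ _ _
    (fun z : T * R => (side_retract (i z.1), z.2)) _ _ cphi).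
  apply: continuous_pair; last exact: continuous_snd.
  apply: (@continuous_compose _ _ _ (fun z : T * R => z.1)
    (fun t => side_retract (i t))); first exact: continuous_fst.
  exact: (continuous_side_retract s_side Ns).
- apply: (@continuous_compose _ _ _
    (fun z : T * R => (barycentric (i z.1) None - 1 / 2, z.2)) _ _ cw).
  by contin.
by move=> z i12; rewrite side_retract_far ?i12 // subrr.
Qed.

(** Reading the path as the segment from [n] to the apex gives a self-map that
moves each point within the simplex spanned by [n] and the simplex of the
point. *)
Lemma arm_near (w : R -> X) (s : {fset option (V + W)}) :
    (forall t, 0 <= t <= 1 / 2 ->
      closed_simplex [fset e n; None]%fset (barycentric (w t))) ->
    (forall c, c \in s -> on_side c) -> simplices (neighborhood_complex G) s ->
  exists2 s', simplices (neighborhood_complex G) s' & forall a : X,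
    closed_simplex s (barycentric a) ->
    closed_simplex s' (barycentric (arm side_incl w a)) /\
    closed_simplex s' (barycentric a).
Proof.
move=> w_apex s_side Gs.
exists (if None \in s then e n |` s else s)%fset.
  case: ifP => // Ns; have [c sc] := Gs.
  apply: (@neighborhood_simplex _ G (e u)) => d; rewrite in_fset1U.
  case/predU1P => [->|ds]; first by rewrite (side_adj side) adj_sym
    (side_root side).
  have := s_side _ ds; case/orP => /eqP dE.
    by rewrite dE adj_sym (side_adj_None side).
  have := sc _ ds; rewrite -dE => /[dup] /(side_adj_in side)[c0|[b cb]].
    by have := sc _ Ns; rewrite c0 adj_irr.
  rewrite cb; have := sc _ Ns.
  by rewrite cb adj_sym (side_adj_None side) => /eqP ->.
move=> a sa; have ss' : (s `<=` if None \in s then e n |` s else s)%fset.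
  by case: ifP => // _; exact: fsubsetUr.
split; last exact: closed_simplexS sa.
rewrite /arm; case: leP => a12.
  rewrite side_inclE (side_retractE s_side Gs sa).
  apply: closed_simplexS (closed_simplex_extend
    (closed_simplex_retract s_side sa)).
  apply/fsubsetP => _ /imfsetP[_ /imfsetP[c /= cs ->] ->].
  have := s_side _ cs; case/orP => /eqP cE.
    by move: cs; rewrite cE (side_None side) => ->; rewrite fset1U1.
  by rewrite cE; exact: (fsubsetP ss').
have Ns : None \in s.
  by apply: contraLR a12 => Ns; rewrite -leNgt; case: sa => _ -> //; lra.
have [a0 a1] := andP (coord_itv a None).
apply: closed_simplexS (w_apex _ _); last by apply/andP; split; lra.
rewrite Ns; apply/fsubsetP => c; rewrite !inE => /orP[->//|/eqP ->].
by rewrite Ns orbT.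
Qed.

End Side.

(** * Maps out of the neighborhood complex of the join *)

Section Join.
Context {R : realType} {V W : choiceType} {H : graph V} {K : graph W}.
Context {x : V} {y : W} {h : V} {k : W} (xh : H x h) (yk : K y k).
Let G := join_graph H K x y.
Let X := realization R (neighborhood_complex G).
Let A := realization R (neighborhood_complex H).
Let B := realization R (neighborhood_complex K).
Context (o : X) (p : A) (q : B).

Definition left_in (v : V) : option (V + W) := Some (inl v).
Definition right_in (w : W) : option (V + W) := Some (inr w).
Definition left_out (v0 : V) (c : option (V + W)) : V :=
  if c is Some (inl v) then v else v0.
Definition right_out (w0 : W) (c : option (V + W)) : W :=
  if c is Some (inr w) then w else w0.

Lemma left_side : is_side (x := x) (y := y) (H := H) (K := K)
  H x h left_in (left_out h).
Proof.
by split => //= a [[b|b]|] //; [right; exists b|left].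
Qed.

Lemma right_side : is_side (x := x) (y := y) (H := H) (K := K)
  K y k right_in (right_out k).
Proof.
by split => //= a [[b|b]|] //; [right; exists b|left].
Qed.

Definition left_incl : A -> X := @side_incl R V W H K x y V H left_in
  (left_out h) o.
Definition right_incl : B -> X :=
  @side_incl R V W H K x y W K right_in (right_out k) o.

Definition left_arm {Y : Type} (phi : A -> Y) (w : R -> Y) : X -> Y :=
  @arm R V W H K x y V H h left_in p Y phi w.
Definition right_arm {Y : Type} (phi : B -> Y) (w : R -> Y) : X -> Y :=
  @arm R V W H K x y W K k right_in q Y phi w.

Definition left_support (a : X) := forall w : W, barycentric a (Some (inr w)) =
  0.
Definition right_support (a : X) := forall v : V, barycentric a (Some (inl v))
  = 0.

(** The first path is followed from left to right; so it is read backwards on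
the right arm, and the apex is its midpoint. On the edge from x to y the
coordinate of y is the parameter of the second path. *)
Definition join_elim {Y : Type} (phiA : A -> Y) (phiB : B -> Y) (w0 w1 : R -> Y)
    (a : X) : Y :=
  if pselect (left_support a) then left_arm phiA w0 a
  else if pselect (right_support a) then right_arm phiB (fun t => w0 (1 - t)) a
  else w1 (barycentric a (Some (inr y))).

Lemma join_elim_comp {Y Z : Type} (f : Y -> Z) (phiA : A -> Y) (phiB : B -> Y)
    (w0 w1 : R -> Y) a :
  f (join_elim phiA phiB w0 w1 a) =
  join_elim (fun a => f (phiA a)) (fun b => f (phiB b)) (fun t => f (w0 t))
    (fun t => f (w1 t)) a.
Proof.
rewrite /join_elim /left_arm /right_arm /arm.
by case: pselect => // ?; [|case: pselect => // ?]; case: ifP.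
Qed.

Lemma join_elim_left {Y : Type} (phiA : A -> Y) (phiB : B -> Y)
  (w0 w1 : R -> Y) a :
  left_support a -> join_elim phiA phiB w0 w1 a = left_arm phiA w0 a.
Proof. by rewrite /join_elim; case: pselect. Qed.

(** The two arms agree where both apply, which is only at the apex. *)
Lemma join_elim_right {Y : Type} (phiA : A -> Y) (phiB : B -> Y)
  (w0 w1 : R -> Y) a :
  right_support a ->
  join_elim phiA phiB w0 w1 a = right_arm phiB (fun t => w0 (1 - t)) a.
Proof.
move=> ra; rewrite /join_elim; case: pselect => [la|nla] /=;
  last by case: pselect.
have [s _ sa] := carrier_simplex a.
have [_ _ aN] : closed_simplex [fset None]%fset (barycentric a).
  by apply: (closed_simplex_support sa) => -[[v|w]|]; rewrite ?inE.
rewrite big_seq_fset1 in aN.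
have half_lt1 : (1 <= 1 / 2 :> R) = false by apply/negbTE; rewrite -ltNge; lra.
rewrite /left_arm /right_arm /arm aN half_lt1.
by congr w0; lra.
Qed.

Lemma join_elim_left_incl {Y : Type} (phiA : A -> Y) (phiB : B -> Y)
  (w0 w1 : R -> Y) a :
  join_elim phiA phiB w0 w1 (left_incl a) = phiA a.
Proof.
rewrite join_elim_left; first by rewrite /left_arm /left_incl
  (arm_incl left_side).
by move=> w; rewrite /left_incl (side_inclE left_side).
Qed.

Lemma join_elim_right_incl {Y : Type} (phiA : A -> Y) (phiB : B -> Y)
  (w0 w1 : R -> Y) b :
  join_elim phiA phiB w0 w1 (right_incl b) = phiB b.
Proof.
rewrite join_elim_right; first by rewrite /right_arm /right_incl
  (arm_incl right_side).
by move=> v; rewrite /right_incl (side_inclE right_side).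
Qed.

Definition apex : X := vertex o None.
Definition arc0 (t : R) : X :=
  if t <= 1 / 2 then segment (left_incl (vertex p h)) apex (2 * t)
  else segment apex (right_incl (vertex q k)) (2 * t - 1).
Definition arc1 (t : R) : X :=
  segment (left_incl (vertex p x)) (right_incl (vertex q y)) t.

Lemma apexE : barycentric apex = vertex_coord None.
Proof. by apply: (@barycentric_vertex _ _ G _ _ (left_in x)) => /=;
  exact: eqxx. Qed.

Lemma left_incl_vertexE u v : H u v ->
  barycentric (left_incl (vertex p u)) = vertex_coord (left_in u).
Proof.
move=> uv; rewrite /left_incl (side_inclE left_side) (barycentric_vertex _ uv).
by apply/funext => -[[a|a]|] //; rewrite /extend /= eqxx.
Qed.

Lemma right_incl_vertexE u v : K u v ->
  barycentric (right_incl (vertex q u)) = vertex_coord (right_in u).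
Proof.
move=> uv; rewrite /right_incl (side_inclE right_side)
  (barycentric_vertex _ uv).
by apply/funext => -[[a|a]|] //; rewrite /extend /= eqxx.
Qed.

Lemma segmentE (s : {fset option (V + W)}) (a b : X) c :
    simplices (neighborhood_complex G) s ->
    closed_simplex s (barycentric a) -> closed_simplex s (barycentric b) ->
  barycentric (segment a b c) =
  segment_point (barycentric a) (barycentric b) (clamp c).
Proof.
move=> Gs sa sb; apply: (realizeK _ Gs).
by apply: closed_simplex_convex => //; exact: clamp_itv.
Qed.

Lemma left_edge_simplex :
  simplices (neighborhood_complex G) [fset left_in h; None]%fset.
Proof.
apply: (@neighborhood_simplex _ G (left_in x)) => c; rewrite !inE.
by case/orP => /eqP -> /=; rewrite ?eqxx // adj_sym.
Qed.

Lemma right_edge_simplex :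
  simplices (neighborhood_complex G) [fset right_in k; None]%fset.
Proof.
apply: (@neighborhood_simplex _ G (right_in y)) => c; rewrite !inE.
by case/orP => /eqP -> /=; rewrite ?eqxx // adj_sym.
Qed.

Lemma cross_edge_simplex :
  simplices (neighborhood_complex G) [fset left_in x; right_in y]%fset.
Proof.
apply: (@neighborhood_simplex _ G None) => c; rewrite !inE.
by case/orP => /eqP -> /=; rewrite eqxx.
Qed.

Lemma closed_edge_left (c d : option (V + W)) :
  closed_simplex [fset c; d]%fset (vertex_coord c : _ -> R).
Proof. by apply: closed_simplex_vertex; rewrite !inE eqxx. Qed.

Lemma closed_edge_right (c d : option (V + W)) :
  closed_simplex [fset c; d]%fset (vertex_coord d : _ -> R).
Proof. by apply: closed_simplex_vertex; rewrite !inE eqxx orbT. Qed.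

Lemma arc0_leftE t : t <= 1 / 2 -> barycentric (arc0 t) =
  segment_point (vertex_coord (left_in h)) (vertex_coord None) (clamp (2 * t)).
Proof.
have hx : H h x by rewrite adj_sym.
move=> t12; rewrite /arc0 t12 (segmentE _ left_edge_simplex).
- by rewrite apexE (left_incl_vertexE hx).
- by rewrite (left_incl_vertexE hx); exact: closed_edge_left.
- by rewrite apexE; exact: closed_edge_right.
Qed.

Lemma arc0_rightE t : 1 / 2 <= t -> barycentric (arc0 t) =
  segment_point (vertex_coord None) (vertex_coord (right_in k))
    (clamp (2 * t - 1)).
Proof.
have ky : K k y by rewrite adj_sym.
move=> t12; rewrite /arc0; case: leP => t12'.
  have -> : t = 1 / 2 by lra.
  have -> : 2 * (1 / 2) = 1 :> R by lra.
  rewrite segment1 subrr clamp0 apexE.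
  by apply/funext => c; rewrite /segment_point; lra.
rewrite (segmentE _ right_edge_simplex).
- by rewrite apexE (right_incl_vertexE ky).
- by rewrite apexE; exact: closed_edge_right.
- by rewrite (right_incl_vertexE ky); exact: closed_edge_left.
Qed.

Lemma arc1E t : barycentric (arc1 t) =
  segment_point (vertex_coord (left_in x)) (vertex_coord (right_in y))
    (clamp t).
Proof.
rewrite /arc1 (segmentE _ cross_edge_simplex).
- by rewrite (left_incl_vertexE xh) (right_incl_vertexE yk).
- by rewrite (left_incl_vertexE xh); exact: closed_edge_left.
- by rewrite (right_incl_vertexE yk); exact: closed_edge_right.
Qed.

Lemma arc0_0 : arc0 0 = left_incl (vertex p h).
Proof. by rewrite /arc0 ifT ?mulr0 ?segment0 //; lra. Qed.

Lemma arc0_1 : arc0 1 = right_incl (vertex q k).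
Proof.
rewrite /arc0 ifF; last by apply/negbTE; rewrite -ltNge; lra.
have -> : 2 * 1 - 1 = 1 :> R by lra.
exact: segment1.
Qed.

Lemma arc1_0 : arc1 0 = left_incl (vertex p x). Proof. exact: segment0. Qed.
Lemma arc1_1 : arc1 1 = right_incl (vertex q y). Proof. exact: segment1. Qed.

Lemma continuous_arc0 : continuous arc0.
Proof.
have hx : H h x by rewrite adj_sym.
have ky : K k y by rewrite adj_sym.
apply: continuous_if; contin.
- apply: (continuous_segment left_edge_simplex); contin => t.
    by rewrite (left_incl_vertexE hx); exact: closed_edge_left.
  by rewrite apexE; exact: closed_edge_right.
- apply: (continuous_segment right_edge_simplex); contin => t.
    by rewrite apexE; exact: closed_edge_right.
  by rewrite (right_incl_vertexE ky); exact: closed_edge_left.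
move=> t ->; have -> : 2 * (1 / 2) = 1 :> R by lra.
by rewrite subrr segment0 segment1.
Qed.

Lemma continuous_arc1 : continuous arc1.
Proof.
apply: (continuous_segment cross_edge_simplex); contin => t.
  by rewrite (left_incl_vertexE xh); exact: closed_edge_left.
by rewrite (right_incl_vertexE yk); exact: closed_edge_right.
Qed.

Section Compatible.
Context {Y : Type} (phiA : A -> Y) (phiB : B -> Y) (w0 w1 : R -> Y).
Context (w00 : phiA (vertex p h) = w0 0) (w01 : phiB (vertex q k) = w0 1).
Context (w10 : phiA (vertex p x) = w1 0) (w11 : phiB (vertex q y) = w1 1).

(** The quarters of the arc next to its ends lie in the part of the cones that
is retracted to the bases, hence the clamped parameter. *)
Lemma join_elim_arc0 t : 0 <= t <= 1 ->
  join_elim phiA phiB w0 w1 (arc0 t) = w0 (clamp (2 * t - 1 / 2)).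
Proof.
case/andP => t0 t1; have [t12|t12] := leP t (1 / 2).
  have E := arc0_leftE t12.
  rewrite join_elim_left; last first.
    by move=> w; rewrite E /segment_point /vertex_coord /=; lra.
  have EN : barycentric (arc0 t) None = 2 * t.
    rewrite E /segment_point /vertex_coord /= clamp_id; last by apply/andP;
      split; lra.
    by lra.
  rewrite /left_arm /arm EN; case: leP => t14; last first.
    by rewrite clamp_id //; apply/andP; split; lra.
  rewrite /clamp (@min_r _ _ 1) ?max_l; [|lra|lra].
  rewrite -w00; congr phiA; rewrite /side_retract /vertex; congr realize.
  apply/funext => v; rewrite /retract_coord /segment_point /fold_coord
    /apex_half EN E.
  rewrite min_l ?clamp_id //; last by apply/andP; split; lra.
  rewrite /segment_point /vertex_coord /= /left_in.
  rewrite (inj_eq (can_inj (side_can left_side))).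
  by case: (v == h); rewrite /=; nra.
have t12' := ltW t12; have E := arc0_rightE t12'.
rewrite join_elim_right; last first.
  by move=> v; rewrite E /segment_point /vertex_coord /=; lra.
have EN : barycentric (arc0 t) None = 2 - 2 * t.
  rewrite E /segment_point /vertex_coord /= clamp_id; last by apply/andP;
    split; lra.
  by lra.
rewrite /right_arm /arm EN; case: leP => t34; last first.
  rewrite clamp_id; last by apply/andP; split; lra.
  by congr w0; lra.
rewrite /clamp (@min_l _ _ 1) ?max_r; [|lra|lra].
rewrite -w01; congr phiB; rewrite /side_retract /vertex; congr realize.
apply/funext => v; rewrite /retract_coord /segment_point /fold_coord /apex_half
  EN E.
rewrite min_l ?clamp_id //; last by apply/andP; split; lra.
rewrite /segment_point /vertex_coord /= /right_in.
rewrite (inj_eq (can_inj (side_can right_side))).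
by case: (v == k); rewrite /=; nra.
Qed.

Lemma join_elim_arc1 t : 0 <= t <= 1 -> join_elim phiA phiB w0 w1 (arc1 t) = w1
  t.
Proof.
case/andP => t0 t1.
have [->|tn0] := eqVneq t 0; first by rewrite arc1_0 join_elim_left_incl.
have [->|tn1] := eqVneq t 1; first by rewrite arc1_1 join_elim_right_incl.
have E : barycentric (arc1 t) = segment_point (vertex_coord (left_in x))
    (vertex_coord (right_in y)) t by rewrite arc1E clamp_id // t0.
rewrite /join_elim; case: pselect => [/(_ y)|nl] /=.
  rewrite E /segment_point /vertex_coord /= eqxx => t_0.
  by case/eqP: tn0; move: t_0; rewrite /=; lra.
case: pselect => [/(_ x)|nr] /=.
  rewrite E /segment_point /vertex_coord /= eqxx => t_1.
  by case/eqP: tn1; move: t_1; rewrite /=; lra.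
rewrite E /segment_point /vertex_coord /= eqxx; congr w1.
by rewrite /=; lra.
Qed.

End Compatible.

Lemma cross_edge_point (s : {fset option (V + W)}) (a : X) :
    (forall c, c \in s -> c = left_in x \/ c = right_in y) ->
    closed_simplex s (barycentric a) ->
  a = arc1 (barycentric a (right_in y)) /\ 0 <= barycentric a (right_in y) <= 1.
Proof.
move=> sxy sa.
have : closed_simplex [fset left_in x; right_in y]%fset (barycentric a).
  apply: closed_simplexS sa; apply/fsubsetP => c /sxy[]->.
    by rewrite !inE eqxx.
  by rewrite !inE eqxx orbT.
case=> a0 aout; rewrite big_fsetU1 /= ?inE // big_seq_fset1 => a1.
have ay : 0 <= barycentric a (right_in y) <= 1.
  by rewrite a0 andTb -a1 lerDr a0.
split => //; apply: barycentric_inj => c.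
rewrite arc1E clamp_id // /segment_point /vertex_coord.
have [->|cx] := eqVneq c (left_in x); first by rewrite ?eqxx /=; lra.
have [->|cy] := eqVneq c (right_in y); first by rewrite ?eqxx /=; lra.
by rewrite aout ?inE ?negb_or ?cx //= ; lra.
Qed.

Variant simplex_spec (s : {fset option (V + W)}) : Prop :=
| LeftSimplex of (forall c, c \in s -> on_side (e := left_in)
  (e' := left_out h) c)
| RightSimplex of (forall c, c \in s -> on_side (e := right_in)
  (e' := right_out k) c)
| CrossSimplex of (forall c, c \in s -> c = left_in x \/ c = right_in y).

Lemma simplexP s : simplices (neighborhood_complex G) s -> simplex_spec s.
Proof.
case=> -[[v|w]|] sv.
- apply: LeftSimplex => -[[a|a]|] /sv //= _; rewrite /on_side ?eqxx ?orbT //.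
- apply: RightSimplex => -[[a|a]|] /sv //= _; rewrite /on_side ?eqxx ?orbT //.
- by apply: CrossSimplex => -[[a|a]|] /sv //= /eqP ->; [left|right].
Qed.

Lemma left_simplex_support (s : {fset option (V + W)}) (a : X) :
    (forall c, c \in s -> on_side (e := left_in) (e' := left_out h) c) ->
  closed_simplex s (barycentric a) -> left_support a.
Proof.
move=> s_side [_ sa _] w; apply: sa; apply/negP => /s_side.
by rewrite /on_side /=.
Qed.

Lemma right_simplex_support (s : {fset option (V + W)}) (a : X) :
    (forall c, c \in s -> on_side (e := right_in) (e' := right_out k) c) ->
  closed_simplex s (barycentric a) -> right_support a.
Proof.
move=> s_side [_ sa _] w; apply: sa; apply/negP => /s_side.
by rewrite /on_side /=.
Qed.

Lemma continuous_join_elim {Y : topologicalType} (phiA : R -> A -> Y)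
    (phiB : R -> B -> Y) (w0 w1 : R -> R -> Y) :
    continuous (fun z : A * R => phiA z.2 z.1) ->
    continuous (fun z : B * R => phiB z.2 z.1) ->
    continuous (fun z : R * R => w0 z.2 z.1) ->
    continuous (fun z : R * R => w1 z.2 z.1) ->
    (forall t, phiA t (vertex p h) = w0 t 0) ->
    (forall t, phiB t (vertex q k) = w0 t 1) ->
    (forall t, phiA t (vertex p x) = w1 t 0) ->
    (forall t, phiB t (vertex q y) = w1 t 1) ->
  continuous (fun z : X * R => join_elim (phiA z.2) (phiB z.2) (w0 z.2)
    (w1 z.2) z.1).
Proof.
move=> cA cB c0 c1 w00 w01 w10 w11.
apply: continuous_prod_from_simplices => T i s Gs ci si /=.
case: (simplexP Gs) => sP.
- apply: (@continuous_ext _ _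
    (fun z : T * R => left_arm (phiA z.2) (w0 z.2) (i z.1))) => [z|].
    by rewrite join_elim_left //; apply: left_simplex_support sP _.
  exact: (continuous_arm left_side cA c0 _ sP).
- apply: (@continuous_ext _ _ (fun z : T * R =>
    right_arm (phiB z.2) (fun t => w0 z.2 (1 - t)) (i z.1))) => [z|].
    by rewrite join_elim_right //; apply: right_simplex_support sP _.
  apply: (@continuous_arm _ _ _ _ _ _ _ _ _ _ _ _ _ right_side _ _ phiB
    (fun u t => w0 u (1 - t))  _ _ s) => //.
    apply: (@continuous_compose _ _ _ (fun z : R * R => (1 - z.1, z.2)) _ _ c0).
    by contin.
  by move=> t; rewrite subr0.
apply: (@continuous_ext _ _
  (fun z : T * R => w1 z.2 (barycentric (i z.1) (right_in y)))) => [z|].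
  have [iE ir] := cross_edge_point sP (si z.1).
  by rewrite {2}iE join_elim_arc1.
apply: (@continuous_compose _ _ _
  (fun z : T * R => (barycentric (i z.1) (right_in y), z.2)) _ _ c1).
apply: continuous_pair; last exact: continuous_snd.
apply: (@continuous_compose _ _ _ (fun z : T * R => i z.1)
  (fun a : X => barycentric a (right_in y))); last exact: continuous_coord.
by apply: continuous_compose ci; contin.
Qed.

(** Rebuilding X from its own pieces collapses the two cones, which stays
within simplices. *)
Lemma join_elim_canonical_homot :
  homot (R := R) (join_elim left_incl right_incl arc0 arc1) (fun a : X => a).
Proof.
apply: homot_segment.
- have cE := @continuous_join_elim X (fun=> left_incl) (fun=> right_incl)
  (fun=> arc0)
    (fun=> arc1).
  apply: (@continuous_compose _ _ _ (fun a : X => (a, 0 : R)) _ _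
    (cE _ _ _ _ _ _ _ _)).
  + by contin.
  + apply: (@continuous_compose _ _ _ (fun z : A * R => z.1)); contin.
    exact: (continuous_side_incl left_side).
  + apply: (@continuous_compose _ _ _ (fun z : B * R => z.1)); contin.
    exact: (continuous_side_incl right_side).
  + apply: (@continuous_compose _ _ _ (fun z : R * R => z.1)); contin.
    exact: continuous_arc0.
  + apply: (@continuous_compose _ _ _ (fun z : R * R => z.1)); contin.
    exact: continuous_arc1.
  + by rewrite arc0_0.
  + by rewrite arc0_1.
  + by rewrite arc1_0.
  + by rewrite arc1_1.
- exact: continuous_ident.
move=> s Gs; case: (simplexP Gs) => sP.
- have [t|s' Gs' s'P] := arm_near left_side o p (w := arc0) _ sP Gs.
    case/andP=> t0 t12; rewrite arc0_leftE //.
    apply: closed_simplex_convex; first exact: clamp_itv.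
      exact: closed_edge_left.
    exact: closed_edge_right.
  exists s' => // a sa; rewrite join_elim_left; first exact: s'P.
  exact: left_simplex_support sa.
- have [t|s' Gs' s'P] := arm_near right_side o q (w := fun t => arc0 (1 - t))
      _ sP Gs.
    case/andP=> t0 t12; rewrite arc0_rightE //; last by lra.
    apply: closed_simplex_convex; first exact: clamp_itv.
      exact: closed_edge_right.
    exact: closed_edge_left.
  exists s' => // a sa; rewrite join_elim_right; first exact: s'P.
  exact: right_simplex_support sa.
exists s => // a sa; have [aE ar] := cross_edge_point sP sa.
suff -> : join_elim left_incl right_incl arc0 arc1 a = a by [].
by rewrite {1}aE join_elim_arc1 // ?arc1_0 ?arc1_1.
Qed.

End Join.

(** * The circle as the image of a closed path *)

Section Circle.
Context {R : realType}.

Lemma continuous_into_matrix {T : topologicalType} m n (f : T -> 'M[R]_(m, n)) :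
  (forall i j, continuous (fun t => f t i j)) -> continuous f.
Proof.
move=> cf t U [P tP PU].
have : \forall t' \near t, forall i j, P i j (f t' i j).
  by apply: filter_forall => i; apply: filter_forall => j; exact: cf.
by apply: filterS => t' Pt'; exact: PU.
Qed.

Lemma continuous_into_set {T X : topologicalType} {A : set X} (f : T -> A) :
  continuous (fun t => \val (f t)) -> continuous f.
Proof. by move=> cf; exact: continuous_comp_initial. Qed.

Lemma continuous_set_val {X : topologicalType} {A : set X} :
  continuous (fun a : A => \val a).
Proof. exact: initial_continuous. Qed.

Notation circle := (euclidean_sphere R 2).
Implicit Types (u v s : circle).

Definition cx u : R := \val u ord0 0.
Definition cy u : R := \val u ord0 1.

Lemma continuous_entry m n (A : set 'M[R]_(m, n)) i j :
  continuous (fun a : A => \val a i j).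
Proof. exact: (continuous_compose continuous_set_val
  (@coord_continuous _ _ _ i j)). Qed.

Lemma continuous_cx : continuous cx. Proof. exact: continuous_entry. Qed.
Lemma continuous_cy : continuous cy. Proof. exact: continuous_entry. Qed.

Lemma euclidean_sphere2 (a : 'rV[R]_2) :
  euclidean_sphere R 2 a <-> a ord0 0 ^+ 2 + a ord0 1 ^+ 2 = 1.
Proof.
rewrite /euclidean_sphere /= big_ord_recl big_ord1.
by rewrite (_ : lift ord0 ord0 = 1 :> 'I_2) //; exact: val_inj.
Qed.

Lemma circle_eq u : cx u ^+ 2 + cy u ^+ 2 = 1.
Proof. exact/euclidean_sphere2/(set_mem (valP u)). Qed.

Lemma circle_inj u v : cx u = cx v -> cy u = cy v -> u = v.
Proof.
move=> uvx uvy; apply: val_inj; apply/rowP => i; rewrite -!(ord1 ord0).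
have [->|->] : i = 0 \/ i = 1.
  by case: i => [[|[|//]] ?]; [left|right]; exact: val_inj.
- exact: uvx.
- exact: uvy.
Qed.

Definition row2 (a b : R) : 'rV[R]_2 := \row_i (if i == 0 then a else b).

Definition circle_point s (a b : R) : circle :=
  if pselect (euclidean_sphere R 2 (row2 a b)) is left ab
  then exist _ (row2 a b) (mem_set ab) else s.

Lemma circle_pointE s a b : a ^+ 2 + b ^+ 2 = 1 ->
  cx (circle_point s a b) = a /\ cy (circle_point s a b) = b.
Proof.
move=> ab; rewrite /circle_point; case: pselect => [ab'|]; last first.
  by case; apply/euclidean_sphere2; rewrite !mxE.
by rewrite /cx /cy /= !mxE.
Qed.

Lemma continuous_into_circle {T : topologicalType} (f : T -> circle) :
  continuous (fun t => cx (f t)) -> continuous (fun t => cy (f t)) ->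
  continuous f.
Proof.
move=> cfx cfy; apply: continuous_into_set;
  apply: continuous_into_matrix => i j.
rewrite (ord1 i); have [->|->] : j = 0 \/ j = 1.
  by case: j => [[|[|//]] ?]; [left|right]; exact: val_inj.
- exact: cfx.
- exact: cfy.
Qed.

Context (s : circle).

(** Coordinates in the orthonormal frame whose first vector is the base point.
*)
Definition along u : R := cx u * cx s + cy u * cy s.
Definition across u : R := cy u * cx s - cx u * cy s.

Lemma continuous_along : continuous along.
Proof. by move: continuous_cx continuous_cy => ? ?; rewrite /along; contin. Qed.

Lemma continuous_across : continuous across.
Proof. by move: continuous_cx continuous_cy => ? ?; rewrite /across;
  contin. Qed.

Lemma along_across u : along u ^+ 2 + across u ^+ 2 = 1.
Proof.
transitivity ((cx u ^+ 2 + cy u ^+ 2) * (cx s ^+ 2 + cy s ^+ 2)).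
  by rewrite /along /across; lra.
by rewrite !circle_eq mulr1.
Qed.

Lemma along_itv u : -1 <= along u <= 1.
Proof.
have := along_across u; have := sqr_ge0 (across u).
by move=> ? ?; apply/andP; split; nra.
Qed.

Definition frame_point (c d : R) : circle :=
  circle_point s (c * cx s - d * cy s) (c * cy s + d * cx s).

Lemma frame_pointE c d : c ^+ 2 + d ^+ 2 = 1 ->
  [/\ cx (frame_point c d) = c * cx s - d * cy s,
      cy (frame_point c d) = c * cy s + d * cx s,
      along (frame_point c d) = c & across (frame_point c d) = d].
Proof.
move=> cd; have s1 := circle_eq s.
have [Ex Ey] : cx (frame_point c d) = c * cx s - d * cy s /\
    cy (frame_point c d) = c * cy s + d * cx s.
  apply: circle_pointE.
  transitivity ((c ^+ 2 + d ^+ 2) * (cx s ^+ 2 + cy s ^+ 2)); first by lra.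
  by rewrite cd s1 mulr1.
rewrite /along /across Ex Ey; split => //.
- by transitivity (c * (cx s ^+ 2 + cy s ^+ 2)); [lra|rewrite s1 mulr1].
- by transitivity (d * (cx s ^+ 2 + cy s ^+ 2)); [lra|rewrite s1 mulr1].
Qed.

Lemma frame_point_eq u : frame_point (along u) (across u) = u.
Proof.
have [Ex Ey _ _] := frame_pointE (along_across u); have s1 := circle_eq s.
apply: circle_inj; rewrite ?Ex ?Ey /along /across.
- by transitivity (cx u * (cx s ^+ 2 + cy s ^+ 2)); [lra|rewrite s1 mulr1].
- by transitivity (cy u * (cx s ^+ 2 + cy s ^+ 2)); [lra|rewrite s1 mulr1].
Qed.

(** The closed path has a piecewise affine first coordinate: from 1 to -1 and
back. The second coordinate is then a square root, and no trigonometric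
function is needed. *)
Definition loop_along (t : R) : R :=
  Num.max (1 - 4 * clamp t) (4 * clamp t - 3).
Definition loop_across (t : R) : R :=
  let d := Num.sqrt (1 - loop_along t ^+ 2) in if t <= 1 / 2 then d else - d.

Lemma loop_along_itv t : -1 <= loop_along t <= 1.
Proof.
have /andP[? ?] := clamp_itv t; rewrite /loop_along.
by case: (leP (1 - 4 * clamp t)) => ?; apply/andP; split; lra.
Qed.

Lemma loop_circle t : loop_along t ^+ 2 + loop_across t ^+ 2 = 1.
Proof.
have [c0 c1] := andP (loop_along_itv t).
have d0 : 0 <= 1 - loop_along t ^+ 2 by nra.
by rewrite /loop_across; case: ifP => _; rewrite ?sqrrN sqr_sqrtr //; lra.
Qed.

Lemma continuous_loop_along : continuous loop_along.
Proof. by have := @continuous_clamp R; rewrite /loop_along => ?; contin. Qed.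

Lemma continuous_loop_across : continuous loop_across.
Proof.
have cl := continuous_loop_along.
have cd : continuous (fun t => Num.sqrt (1 - loop_along t ^+ 2)).
  apply: (@continuous_compose _ _ _ (fun t => 1 - loop_along t ^+ 2) Num.sqrt).
    by contin.
  exact: sqrt_continuous.
rewrite /loop_across; apply: continuous_if; contin => t ->.
have -> : loop_along (1 / 2) = -1.
  rewrite /loop_along clamp_id; last by apply/andP; split; lra.
  by case: leP => ?; lra.
by rewrite sqrrN expr1n subrr sqrtr0 oppr0.
Qed.

Definition loop (t : R) : circle := frame_point (loop_along t) (loop_across t).

Lemma continuous_loop : continuous loop.
Proof.
have [ca cd] := (continuous_loop_along, continuous_loop_across).
apply: continuous_into_circle.
- apply: (@continuous_ext _ _
  (fun t => loop_along t * cx s - loop_across t * cy s)).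
    by move=> t; have [-> _ _ _] := frame_pointE (loop_circle t).
  by contin.
- apply: (@continuous_ext _ _
  (fun t => loop_along t * cy s + loop_across t * cx s)).
    by move=> t; have [_ -> _ _] := frame_pointE (loop_circle t).
  by contin.
Qed.

Lemma frame_point10 : frame_point 1 0 = s.
Proof.
have e : 1 ^+ 2 + 0 ^+ 2 = 1 :> R by rewrite expr1n expr0n addr0.
have [Ex Ey _ _] := frame_pointE e.
by apply: circle_inj; rewrite ?Ex ?Ey; lra.
Qed.

Lemma loop0 : loop 0 = s.
Proof.
rewrite /loop /loop_across /loop_along clamp0 max_l; last by lra.
have -> : 1 - 4 * 0 = 1 :> R by lra.
by rewrite expr1n subrr sqrtr0 oppr0 if_same frame_point10.
Qed.

Lemma loop1 : loop 1 = s.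
Proof.
rewrite /loop /loop_across /loop_along clamp1 max_r; last by lra.
have -> : 4 * 1 - 3 = 1 :> R by lra.
by rewrite expr1n subrr sqrtr0 oppr0 if_same frame_point10.
Qed.

(** The affine function of [along] on each half circle inverts [loop]. The
parameter jumps from 1 to 0 at the base point only. *)
Definition circle_elim {Y : Type} (w : R -> Y) u : Y :=
  if 0 <= across u then w ((1 - along u) / 4) else w ((3 + along u) / 4).

Lemma circle_elim_loop {Y : Type} (w : R -> Y) t : w 0 = w 1 -> 0 <= t <= 1 ->
  circle_elim w (loop t) = w t.
Proof.
move=> w01 /andP[t0 t1].
have [_ _ aE dE] := frame_pointE (loop_circle t).
rewrite /circle_elim /loop aE dE.
have cl : clamp t = t by rewrite clamp_id // t0.
have [t12|t12] := leP t (1 / 2).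
  rewrite /loop_across t12 sqrtr_ge0 /loop_along cl max_l; last by lra.
  by congr w; lra.
have lE : loop_along t = 4 * t - 3.
  by rewrite /loop_along cl max_r; lra.
have [->|tn1] := eqVneq t 1.
  rewrite -w01 ifT; first by congr w; rewrite /loop_along clamp1 max_r; lra.
  rewrite /loop_across /loop_along clamp1 max_r; last by lra.
  have -> : 4 * 1 - 3 = 1 :> R by lra.
  by rewrite expr1n subrr sqrtr0 oppr0 if_same.
have tlt1 : t < 1 by rewrite lt_neqAle tn1.
rewrite ifF; last first.
  apply/negbTE; rewrite -ltNge /loop_across ifF; last by apply/negbTE;
    rewrite -ltNge.
  by rewrite oppr_lt0 sqrtr_gt0 lE; nra.
by rewrite lE; congr w; lra.
Qed.

Lemma circle_elim_base {Y : Type} (w : R -> Y) : w 0 = w 1 ->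
  circle_elim w s = w 0.
Proof.
move=> w01; have := @circle_elim_loop _ w 0 w01; rewrite loop0; apply.
by rewrite lexx ler01.
Qed.

Lemma circle_elim_id u : circle_elim loop u = u.
Proof.
have [a0 a1] := andP (along_itv u); have ad := along_across u.
rewrite -[RHS]frame_point_eq /circle_elim.
have sq (t : R) : loop_along t = along u ->
    Num.sqrt (1 - loop_along t ^+ 2) = `|across u|.
  by move=> ->; rewrite -ad addrAC subrr add0r sqrtr_sqr.
case: leP => d0.
  have lE : loop_along ((1 - along u) / 4) = along u.
    rewrite /loop_along clamp_id; last by apply/andP; split; lra.
    by rewrite max_l; lra.
  rewrite /loop /loop_across sq // lE ger0_norm // ifT //; lra.
have lE : loop_along ((3 + along u) / 4) = along u.
  rewrite /loop_along clamp_id; last by apply/andP; split; lra.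
  by rewrite max_r; lra.
rewrite /loop /loop_across sq // lE ltr0_norm // opprK ifF //.
apply/negbTE; rewrite -ltNge.
have : -1 < along u by rewrite lt_neqAle a0 andbT; apply/eqP => a; nra.
by lra.
Qed.

Lemma circle_elim_comp {Y Z : Type} (f : Y -> Z) (w : R -> Y) u :
  f (circle_elim w u) = circle_elim (fun t => f (w t)) u.
Proof. by rewrite /circle_elim; case: ifP. Qed.

Lemma continuous_circle_elim {Y : topologicalType} (w : R -> R -> Y) :
  continuous (fun z : R * R => w z.2 z.1) -> (forall t, w t 0 = w t 1) ->
  continuous (fun z : circle * R => circle_elim (w z.2) z.1).
Proof.
move=> cw w01; rewrite /circle_elim.
have cal : continuous (fun z : circle * R => along z.1).
  exact: (continuous_compose continuous_fst continuous_along).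
have cac : continuous (fun z : circle * R => across z.1).
  exact: (continuous_compose continuous_fst continuous_across).
apply: continuous_if; contin.
- apply: (@continuous_compose _ _ _
    (fun z : circle * R => ((1 - along z.1) / 4, z.2)) _ _ cw).
  by contin.
- apply: (@continuous_compose _ _ _
    (fun z : circle * R => ((3 + along z.1) / 4, z.2)) _ _ cw).
  by contin.
move=> z d0; have := along_across z.1.
rewrite -d0 expr0n addr0 => /eqP; rewrite sqrf_eq1 => /orP[] /eqP ->.
  have -> : (1 - 1) / 4 = 0 :> R by lra.
  have -> : (3 + 1) / 4 = 1 :> R by lra.
  exact: w01.
by congr (w z.2); lra.
Qed.

End Circle.

(** * Maps out of the wedge *)

Section Wedge.
Context {R : realType} {A B S : topologicalType} (p : A) (q : B) (s : S).
Let W := wedge3 p q s.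
Let base (i : 'I_3) : space3 A B S i := point3 p q s i.

Definition wedge_in0 (a : A) : W :=
  @wedge_lift _ _ base (@Ordinal 3 0 isT) a.
Definition wedge_in1 (b : B) : W :=
  @wedge_lift _ _ base (@Ordinal 3 1 isT) b.
Definition wedge_in2 (c : S) : W :=
  @wedge_lift _ _ base (@Ordinal 3 2 isT) c.

Lemma continuous_wedge_in0 : continuous wedge_in0.
Proof. exact: (@wedge_lift_continuous _ _ base (@Ordinal 3 0 isT)). Qed.
Lemma continuous_wedge_in1 : continuous wedge_in1.
Proof. exact: (@wedge_lift_continuous _ _ base (@Ordinal 3 1 isT)). Qed.
Lemma continuous_wedge_in2 : continuous wedge_in2.
Proof. exact: (@wedge_lift_continuous _ _ base (@Ordinal 3 2 isT)). Qed.

Lemma wedge_in01 : wedge_in1 q = wedge_in0 p.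
Proof. exact: (@wedge_liftE _ _ base (@Ordinal 3 0 isT) p (@Ordinal 3 1 isT)
  q). Qed.
Lemma wedge_in02 : wedge_in2 s = wedge_in0 p.
Proof. exact: (@wedge_liftE _ _ base (@Ordinal 3 0 isT) p (@Ordinal 3 2 isT)
  s). Qed.

Definition wedge_family {Y : Type} (fA : A -> Y) (fB : B -> Y) (fS : S -> Y)
    (n : nat) : space3 A B S n -> Y :=
  match n return space3 A B S n -> Y with 0 => fA | 1 => fB | _ => fS end.

Definition wedge_elim {Y : Type} (fA : A -> Y) (fB : B -> Y) (fS : S -> Y) :
    W -> Y :=
  @wedge_fun _ _ base _
    (fun i => wedge_family fA fB fS (n := i)).

Section Elim.
Context {Y : Type} (fA : A -> Y) (fB : B -> Y) (fS : S -> Y).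
Context (fAB : fA p = fB q) (fAS : fA p = fS s).

Lemma wedge_familyE (i j : 'I_3) :
  wedge_family fA fB fS (point3 p q s i) = wedge_family fA fB fS
    (point3 p q s j).
Proof.
have baseE (l : 'I_3) : wedge_family fA fB fS (point3 p q s l) = fA p.
  by case: l => [[|[|[|//]]] ?].
by rewrite !baseE.
Qed.

Lemma wedge_elim_lift (i : 'I_3) (a : space3 A B S i) :
  wedge_elim fA fB fS (wedge_lift base a) =
  wedge_family fA fB fS a.
Proof. by rewrite /wedge_elim wedge_lift_funE //; exact: wedge_familyE. Qed.

Lemma wedge_elim0 a : wedge_elim fA fB fS (wedge_in0 a) = fA a.
Proof. exact: wedge_elim_lift. Qed.
Lemma wedge_elim1 b : wedge_elim fA fB fS (wedge_in1 b) = fB b.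
Proof. exact: wedge_elim_lift. Qed.
Lemma wedge_elim2 c : wedge_elim fA fB fS (wedge_in2 c) = fS c.
Proof. exact: wedge_elim_lift. Qed.

End Elim.

Lemma wedge_elim_comp {Y Z : Type} (f : Y -> Z) (fA : A -> Y) (fB : B -> Y)
    (fS : S -> Y) w :
  f (wedge_elim fA fB fS w) =
  wedge_elim (fun a => f (fA a)) (fun b => f (fB b)) (fun c => f (fS c)) w.
Proof.
rewrite /wedge_elim /wedge_fun /=.
by case: (repr _) => -[[|[|[|//]]] ?] a.
Qed.

Lemma wedge_point (w : W) : exists (i : 'I_3) (a : space3 A B S i),
  wedge_lift base a = w.
Proof.
have : [set: W] w by [].
by rewrite -wedgeTE => -[i _ [a _ aw]]; exists i, a.
Qed.

Lemma wedge_elim_id w : wedge_elim wedge_in0 wedge_in1 wedge_in2 w = w.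
Proof.
have [i [a <-]] := wedge_point w.
rewrite wedge_elim_lift ?wedge_in01 ?wedge_in02 //.
by case: i a => [[|[|[|//]]] lti] a; rewrite (bool_irrelevance lti isT).
Qed.

Lemma continuous_wedge_elim {Y : topologicalType} (fA : R -> A -> Y)
    (fB : R -> B -> Y) (fS : R -> S -> Y) :
    continuous (fun z : A * R => fA z.2 z.1) ->
    continuous (fun z : B * R => fB z.2 z.1) ->
    continuous (fun z : S * R => fS z.2 z.1) ->
    (forall t, fA t p = fB t q) -> (forall t, fA t p = fS t s) ->
  continuous (fun z : W * R => wedge_elim (fA z.2) (fB z.2) (fS z.2) z.1).
Proof.
move=> cA cB cS AB AS.
apply: (@continuous_final_prod R 'I_3 _ _ _
  (fun i => @wedge_lift _ _ base i)).
- by move=> U oU; apply/wedge_openP.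
- exact: wedge_point.
move=> i; apply: (@continuous_ext _ _ (fun z : space3 A B S i * R =>
    wedge_family (fA z.2) (fB z.2) (fS z.2) z.1)) => [z|].
  by rewrite wedge_elim_lift.
by case: i => [[|[|[|//]]] ?].
Qed.

End Wedge.

(** * The circle is not contractible *)

Section NoContraction.
Context {R : realType}.
Notation circle := (euclidean_sphere R 2).

Lemma continuous_invr {T : topologicalType} (f : T -> R) :
  continuous f -> (forall t, f t != 0) -> continuous (fun t => (f t)^-1).
Proof. by move=> cf f0 t; apply: cvgV; [exact: f0|exact: cf]. Qed.

Lemma loop_surj (s : circle) u : exists2 t, 0 <= t <= 1 & loop s t = u.
Proof.
have /andP[a0 a1] := along_itv s u.
have := circle_elim_id s u; rewrite /circle_elim; case: ifP => _ uE.
  by exists ((1 - along s u) / 4) => //; apply/andP; split; lra.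
by exists ((3 + along s u) / 4) => //; apply/andP; split; lra.
Qed.

Definition complex_square (f : circle -> circle) : Prop :=
  exists a b : circle -> R, [/\ continuous a, continuous b,
    forall u, a u ^+ 2 - b u ^+ 2 = cx (f u) &
    forall u, 2 * a u * b u = cy (f u)].

Definition dot (u v : circle) : R := cx u * cx v + cy u * cy v.

(** With z = x + iy, w = x' + iy' on the unit circle and a + ib a square root
of z: C + iD is w / z, and multiplying a + ib by the square root (1 + C + iD)
/ |1 + C + iD| of w / z gives a square root of w. The norm of 1 + C + iD is
the square root of 2(1 + C), and [k] is its inverse up to sign. *)
Lemma square_rotate (a b x y x' y' k : R) :
  let C := x * x' + y * y' in let D := y' * x - x' * y in
  a ^+ 2 - b ^+ 2 = x -> 2 * a * b = y -> x ^+ 2 + y ^+ 2 = 1 ->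
  x' ^+ 2 + y' ^+ 2 = 1 -> k ^+ 2 * (2 * (1 + C)) = 1 ->
  ((a * (1 + C) - b * D) * k) ^+ 2 - ((a * D + b * (1 + C)) * k) ^+ 2 = x' /\
  2 * ((a * (1 + C) - b * D) * k) * ((a * D + b * (1 + C)) * k) = y'.
Proof.
move=> C D ax ay xy1 xy1' iC.
have CD : C ^+ 2 + D ^+ 2 = 1.
  transitivity ((x ^+ 2 + y ^+ 2) * (x' ^+ 2 + y' ^+ 2)).
    by rewrite /C /D; lra.
  by rewrite xy1 xy1' mulr1.
have x'E : x * C - y * D = x'.
  transitivity (x' * (x ^+ 2 + y ^+ 2)); first by rewrite /C /D; lra.
  by rewrite xy1 mulr1.
have y'E : x * D + y * C = y'.
  transitivity (y' * (x ^+ 2 + y ^+ 2)); first by rewrite /C /D; lra.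
  by rewrite xy1 mulr1.
have sqE : (1 + C) ^+ 2 - D ^+ 2 = 2 * (1 + C) * C by lra.
move: iC sqE x'E y'E; clearbody C D => iC sqE x'E y'E; split.
- transitivity (k ^+ 2 * ((a ^+ 2 - b ^+ 2) * ((1 + C) ^+ 2 - D ^+ 2) -
    (2 * a * b) * (2 * (1 + C)) * D)); first by lra.
  rewrite ax ay sqE.
  transitivity (k ^+ 2 * (2 * (1 + C)) * (x * C - y * D)); first by lra.
  by rewrite iC mul1r.
- transitivity (k ^+ 2 * ((a ^+ 2 - b ^+ 2) * (2 * (1 + C)) * D +
    (2 * a * b) * ((1 + C) ^+ 2 - D ^+ 2))); first by lra.
  rewrite ax ay sqE.
  transitivity (k ^+ 2 * (2 * (1 + C)) * (x * D + y * C)); first by lra.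
  by rewrite iC mul1r.
Qed.

(** The quotient g / f stays in the right half plane, so it has a continuous
square root. *)
Lemma complex_square_near (f g : circle -> circle) :
    continuous f -> continuous g -> (forall u, 0 < dot (f u) (g u)) ->
  complex_square f -> complex_square g.
Proof.
move=> cf cg fg [a [b [ca cb abx aby]]].
have cfx : continuous (fun u => cx (f u)) by exact:
  (continuous_compose cf continuous_cx).
have cfy : continuous (fun u => cy (f u)) by exact:
  (continuous_compose cf continuous_cy).
have cgx : continuous (fun u => cx (g u)) by exact:
  (continuous_compose cg continuous_cx).
have cgy : continuous (fun u => cy (g u)) by exact:
  (continuous_compose cg continuous_cy).
pose C u := cx (f u) * cx (g u) + cy (f u) * cy (g u).
pose D u := cy (g u) * cx (f u) - cx (g u) * cy (f u).
have cC : continuous C by rewrite /C; contin.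
have cD : continuous D by rewrite /D; contin.
have C0 u : 0 < 2 * (1 + C u) by have := fg u; rewrite /dot -/(C u); lra.
pose i u := (Num.sqrt (2 * (1 + C u)))^-1.
have ci : continuous i.
  apply: continuous_invr.
    apply: (@continuous_compose _ _ _ (fun u => 2 * (1 + C u)) Num.sqrt).
      by contin.
    exact: sqrt_continuous.
  by move=> u; rewrite gt_eqF // sqrtr_gt0.
have iC u : i u ^+ 2 * (2 * (1 + C u)) = 1.
  rewrite /i -{2}(sqr_sqrtr (ltW (C0 u))) -exprMn mulVf ?expr1n //.
  by rewrite gt_eqF // sqrtr_gt0.
exists (fun u => (a u * (1 + C u) - b u * D u) * i u).
exists (fun u => (a u * D u + b u * (1 + C u)) * i u).
split; [by contin|by contin|move=> u|move=> u].
  by case: (square_rotate (abx u) (aby u) (circle_eq _) (circle_eq _) (iC u)).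
by case: (square_rotate (abx u) (aby u) (circle_eq _) (circle_eq _) (iC u)).
Qed.

(** Rotate the square root 1 of 1, except that -1 has the square root i. *)
Lemma complex_square_const (c : circle) : complex_square (fun=> c).
Proof.
have cc := circle_eq c.
have [c1|c1] := eqVneq (cx c) (-1).
  exists (fun=> 0), (fun=> 1); split; try exact: continuous_const.
    by move=> _; rewrite c1; lra.
  move=> _; rewrite mulr0 mul0r; apply/esym/eqP; rewrite -sqrf_eq0; apply/eqP.
  by move: cc; rewrite c1; lra.
have c0 : 0 < 2 * (1 + cx c).
  suff : -1 < cx c by lra.
  by rewrite lt_neqAle eq_sym c1 /=; nra.
pose i := (Num.sqrt (2 * (1 + cx c)))^-1.
have iC : i ^+ 2 * (2 * (1 + cx c)) = 1.
  rewrite /i -{2}(sqr_sqrtr (ltW c0)) -exprMn mulVf ?expr1n //.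
  by rewrite gt_eqF // sqrtr_gt0.
have := @square_rotate 1 0 1 0 (cx c) (cy c) i.
rewrite /= !(mul1r, mul0r, mulr1, mulr0, addr0, subr0, add0r) expr1n expr0n /=.
rewrite subr0 addr0 => /(_ erefl erefl erefl cc iC)[ex ey].
exists (fun=> (1 + cx c) * i), (fun=> cy c * i).
split; try exact: continuous_const; first by move=> _; exact: ex.
by move=> _; rewrite mulrA in ey *; exact: ey.
Qed.

Lemma loop_half (s : circle) :
  cx (loop s (1 / 2)) = - cx s /\ cy (loop s (1 / 2)) = - cy s.
Proof.
have [-> -> _ _] := frame_pointE s (loop_circle (1 / 2)).
have cl : clamp (1 / 2) = 1 / 2 :> R by rewrite clamp_id //; apply/andP; split;
  lra.
have lE : loop_along (1 / 2) = -1 :> R.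
  by rewrite /loop_along cl max_l; lra.
rewrite /loop_across lE lexx sqrrN expr1n subrr sqrtr0.
by split; lra.
Qed.

(** With h = a + ib a square root of the identity, g is the imaginary part of
h(-u) times the conjugate of h(u), and r the real part. *)
Lemma identity_not_complex_square (s : circle) :
  ~ complex_square (fun u : circle => u).
Proof.
move=> [a [b [ca cb abx aby]]].
pose opp (u : circle) : circle := circle_point s (- cx u) (- cy u).
have oppE u : cx (opp u) = - cx u /\ cy (opp u) = - cy u.
  by apply: circle_pointE; rewrite !sqrrN circle_eq.
have copp : continuous opp.
  have [? ?] := (@continuous_cx R, @continuous_cy R).
  apply: continuous_into_circle.
    by apply: (@continuous_ext _ _ (fun u => - cx u)) => [u|];
      [case: (oppE u)|contin].
  by apply: (@continuous_ext _ _ (fun u => - cy u)) => [u|];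
    [case: (oppE u)|contin].
pose g u := b (opp u) * a u - a (opp u) * b u.
pose r u := a (opp u) * a u + b (opp u) * b u.
have cg : continuous g.
  have cao : continuous (fun u => a (opp u)) by exact: continuous_compose copp
    ca.
  have cbo : continuous (fun u => b (opp u)) by exact: continuous_compose copp
    cb.
  by rewrite /g; contin.
have oppK u : opp (opp u) = u.
  have [x2 y2] := oppE (opp u); have [x1 y1] := oppE u.
  by apply: circle_inj; rewrite ?x2 ?y2 ?x1 ?y1 opprK.
have g_opp u : g (opp u) = - g u by rewrite /g oppK; lra.
have g_neq0 u : g u != 0.
  have [ox oy] := oppE u; have u1 := circle_eq u.
  have rg : r u ^+ 2 - g u ^+ 2 = -1.
    transitivity ((a (opp u) ^+ 2 - b (opp u) ^+ 2) * (a u ^+ 2 - b u ^+ 2) +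
      (2 * a (opp u) * b (opp u)) * (2 * a u * b u)).
      by rewrite /r /g; lra.
    by rewrite !abx !aby ox oy -u1; lra.
  apply/eqP => g0; move: rg; rewrite g0 expr0n subr0 => r1.
  by have := sqr_ge0 (r u); rewrite r1; lra.
pose G t := g (loop s t).
have cG : {within `[0, 1 / 2]%classic, continuous G}.
  have cG : continuous G .
    exact: (continuous_compose (@continuous_loop R s) cg).
  exact: continuous_subspaceT.
have Ghalf : G (1 / 2) = - G 0.
  rewrite /G loop0 -g_opp; congr g; have [hx hy] := loop_half s.
  by have [ox oy] := oppE s; apply: circle_inj; rewrite ?hx ?hy ?ox ?oy.
have half_ge0 : 0 <= 1 / 2 :> R by lra.
have G_between : Num.min (G 0) (G (1 / 2)) <= 0 <= Num.max (G 0) (G (1 / 2)).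
  by rewrite Ghalf; case: (leP (G 0)) => ?; apply/andP; split; lra.
have [t _ Gt] := IVT half_ge0 cG G_between.
by have := g_neq0 (loop s t); rewrite -/(G t) Gt eqxx.
Qed.

(** The set of parameters at which the homotopy is a square is open and
closed. *)
Lemma no_contraction (c : circle) : ~ homot (R := R) (fun u : circle => u)
  (fun=> c).
Proof.
move=> [F [cF F0 F1]].
pose Ft t (u : circle) := F (u, t).
have cFt t : continuous (Ft t).
  apply: (@continuous_compose _ _ _ (fun u : circle => (u, t)) F _ cF).
  by contin.
have near_dot t0 : \forall t \near t0, forall u, 0 < dot (Ft t u) (Ft t0 u).
  pose O := [set z : R * R | 0 < dot (Ft z.1 (loop c z.2))
    (Ft t0 (loop c z.2))].
  have oO : open O.
    have cl : continuous (fun z : R * R => loop c z.2).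
      exact: (continuous_compose continuous_snd (@continuous_loop R c)).
    have cFl : continuous (fun z : R * R => Ft z.1 (loop c z.2)).
      apply: (@continuous_compose _ _ _ (fun z : R * R => (loop c z.2, z.1)) F
        _ cF).
      by apply: continuous_pair => //; exact: continuous_fst.
    have cFl0 : continuous (fun z : R * R => Ft t0 (loop c z.2)).
      exact: (continuous_compose cl (cFt t0)).
    have cd : continuous (fun z : R * R =>
        dot (Ft z.1 (loop c z.2)) (Ft t0 (loop c z.2))).
      have := continuous_compose cFl continuous_cx.
      have := continuous_compose cFl continuous_cy.
      have := continuous_compose cFl0 continuous_cx.
      have := continuous_compose cFl0 continuous_cy.
      by move=> ? ? ? ?; rewrite /dot; contin.
    exact: (@open_comp _ _ _ [set x : R | 0 < x] (fun z _ => cd z)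
      (@open_gt _ 0)).
  have Ot0 tau : `[0, 1]%classic tau -> O (t0, tau).
    by move=> _; rewrite /O /= /dot -!expr2 circle_eq ltr01.
  have := compact_tube (@segment_compact R 0 1) oO Ot0.
  apply: filterS => t tO u; have [tau tau01 <-] := loop_surj c u.
  by apply: tO; rewrite /= in_itv.
pose T := [set t : R | complex_square (Ft t)].
suff T0 : T 0.
  apply: (identity_not_complex_square c); move: T0; rewrite /T /=.
  by congr complex_square; apply/funext => u; rewrite /Ft F0.
have dotC u v : dot u v = dot v u by rewrite /dot; lra.
have near_T t0 : \forall t \near t0, T t <-> T t0.
  have := near_dot t0; apply: filterS => t tt0; split.
    by apply: complex_square_near.
  by apply: complex_square_near => // u; rewrite dotC.
have oT : open T.
  rewrite openE => t0 Tt0; rewrite /interior /=.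
  by have := near_T t0; apply: filterS => t [_]; exact.
have cT : closed T.
  rewrite -[T]setCK; apply: open_closedC; rewrite openE => t0 nTt0.
  rewrite /interior /=.
  by have := near_T t0; apply: filterS => t [Tt _] /Tt.
have cR : connected [set: R] by apply/connected_intervalP => ? ? ? ? ? ?.
suff -> : T = setT by [].
apply: cR; [exists 1|by exists T; rewrite ?setTI|by exists T; rewrite ?setTI].
have -> : T 1 = complex_square (fun=> c).
  by congr complex_square; apply/funext => u; rewrite /Ft F1.
exact: complex_square_const.
Qed.

End NoContraction.

(** * Concatenation and reparametrization of paths *)

Section Concatenation.
Context {R : realType}.

Lemma homot_ext {X Y : topologicalType} (f f' g g' : X -> Y) :
  f =1 f' -> g =1 g' -> homot (R := R) f g -> homot (R := R) f' g'.
Proof. by move=> /funext -> /funext ->. Qed.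

(** Most paths below have three pieces; shorter ones get a constant piece, so
that all of them can be compared piece by piece. *)
Definition cat3 {Y : Type} (u v w : R -> Y) (t : R) : Y :=
  if t <= 1 / 3 then u (3 * t)
  else if t <= 2 / 3 then v (3 * t - 1) else w (3 * t - 2).

Lemma cat3_0 {Y : Type} (u v w : R -> Y) : cat3 u v w 0 = u 0.
Proof. by rewrite /cat3 ifT ?mulr0 //; lra. Qed.

Lemma cat3_1 {Y : Type} (u v w : R -> Y) : cat3 u v w 1 = w 1.
Proof.
rewrite /cat3 ifF; last by apply/negbTE; rewrite -ltNge; lra.
by rewrite ifF; [congr w; lra|apply/negbTE; rewrite -ltNge; lra].
Qed.

Lemma cat3_comp {Y Z : Type} (f : Y -> Z) (u v w : R -> Y) t :
  f (cat3 u v w t) = cat3 (fun t => f (u t)) (fun t => f (v t))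
    (fun t => f (w t)) t.
Proof. by rewrite /cat3; case: ifP => // _; case: ifP. Qed.

Lemma cat3_ext {Y : Type} (u v w u' v' w' : R -> Y) :
    (forall t, 0 <= t <= 1 -> u t = u' t) ->
    (forall t, 0 <= t <= 1 -> v t = v' t) ->
    (forall t, 0 <= t <= 1 -> w t = w' t) ->
  forall t, 0 <= t <= 1 -> cat3 u v w t = cat3 u' v' w' t.
Proof.
move=> uu vv ww t /andP[t0 t1]; rewrite /cat3.
case: leP => t13; first by apply: uu; apply/andP; split; lra.
by case: leP => t23; [apply: vv|apply: ww]; apply/andP; split; lra.
Qed.

Lemma continuous_cat3 {Y : topologicalType} (u v w : R -> R -> Y) :
    continuous (fun z : R * R => u z.2 z.1) ->
    continuous (fun z : R * R => v z.2 z.1) ->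
    continuous (fun z : R * R => w z.2 z.1) ->
    (forall c, u c 1 = v c 0) -> (forall c, v c 1 = w c 0) ->
  continuous (fun z : R * R => cat3 (u z.2) (v z.2) (w z.2) z.1).
Proof.
move=> cu cv cw uv vw; rewrite /cat3.
have sub (a : R) (f : R * R -> Y) : continuous f ->
    continuous (fun z : R * R => f (3 * z.1 - a, z.2)).
  move=> cf; apply: (@continuous_compose _ _ _
    (fun z : R * R => (3 * z.1 - a, z.2))).
    by contin.
  exact: cf.
apply: continuous_if; first by contin.
- by contin.
- by apply: continuous_ext (sub 0 _ cu) => z /=; rewrite subr0.
- apply: continuous_if; [by contin|by contin|exact: (sub 1 _ cv)|exact:
  (sub 2 _ cw)|].
  move=> z ->; have -> : 3 * (2 / 3) - 1 = 1 :> R by lra.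
  by have -> : 3 * (2 / 3) - 2 = 0 :> R by lra.
move=> z ->; rewrite ifT; last by lra.
have -> : 3 * (1 / 3) - 1 = 0 :> R by lra.
by have -> : 3 * (1 / 3) = 1 :> R by lra.
Qed.

Lemma continuous_first {T Y : topologicalType} (f : T -> Y) : continuous f ->
  continuous (fun z : T * R => f z.1).
Proof. by move=> cf; exact: (continuous_compose continuous_fst cf). Qed.

Lemma continuous_at_param {T Y : topologicalType} (F : T * R -> Y) c :
  continuous F -> continuous (fun t => F (t, c)).
Proof.
move=> cF; apply: (@continuous_compose _ _ _ (fun t : T => (t, c)) F _ cF).
by contin.
Qed.

Lemma continuous_cat3_path {Y : topologicalType} (u v w : R -> Y) :
    continuous u -> continuous v -> continuous w -> u 1 = v 0 -> v 1 = w 0 ->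
  continuous (cat3 u v w).
Proof.
move=> cu cv cw uv vw.
have cp : continuous (fun z : R * R => cat3 u v w z.1).
  by apply: (continuous_cat3 (u := fun=> u) (v := fun=> v) (w := fun=> w)) =>
    //;
    exact: continuous_first.
exact: (@continuous_at_param _ _ _ 0 cp).
Qed.

(** A path on the whole line in which the pieces are joined at 0 and 1;
[slide] interpolates between reparametrizations of it. *)
Definition line3 {Y : Type} (u v w : R -> Y) (t : R) : Y :=
  if t <= 0 then u t else if t <= 1 then v t else w t.

Section Line.
Context {Y : Type} (u v w : R -> Y) (uv : u 0 = v 0) (vw : v 1 = w 1).

Lemma line3_l t : t <= 0 -> line3 u v w t = u t.
Proof. by rewrite /line3 => ->. Qed.

Lemma line3_m t : 0 <= t <= 1 -> line3 u v w t = v t.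
Proof.
rewrite /line3 => /andP[t0 ->]; case: leP => // t0'.
by have -> : t = 0 by lra.
Qed.

Lemma line3_r t : 1 <= t -> line3 u v w t = w t.
Proof.
rewrite /line3 => t1; rewrite ifF; last by apply/negbTE; rewrite -ltNge; lra.
by case: leP => // t1'; have -> : t = 1 by lra.
Qed.
End Line.

Lemma continuous_line3 {Y : topologicalType} (u v w : R -> Y) :
    continuous u -> continuous v -> continuous w -> u 0 = v 0 -> v 1 = w 1 ->
  continuous (line3 u v w).
Proof.
move=> cu cv cw uv vw; apply: continuous_if; [by contin|by contin|by []| |].
  by apply: continuous_if; [contin|contin| | |move=> t ->].
by move=> t ->; rewrite ler01.
Qed.

Definition slide (phi psi : R -> R) (c t : R) : R := (1 - c) * phi t + c * psi
  t.

Lemma continuous_slide {Y : topologicalType} (l : R -> Y) (phi psi : R -> R) :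
    continuous l -> continuous phi -> continuous psi ->
  continuous (fun z : R * R => l (slide phi psi z.2 z.1)).
Proof.
move=> cl cphi cpsi.
have c1 := continuous_first cphi; have c2 := continuous_first cpsi.
by apply: continuous_compose cl; rewrite /slide; contin.
Qed.

Lemma slide0 phi psi t : slide phi psi 0 t = phi t.
Proof. by rewrite /slide; lra. Qed.
Lemma slide1 phi psi t : slide phi psi 1 t = psi t.
Proof. by rewrite /slide; lra. Qed.
Lemma slide_fix phi psi c t : phi t = psi t -> slide phi psi c t = psi t.
Proof. by rewrite /slide => ->; lra. Qed.

Lemma circle_elim_ext {Y : Type} (s : euclidean_sphere R 2) (w w' : R -> Y) u :
  (forall t, 0 <= t <= 1 -> w t = w' t) -> circle_elim s w u = circle_elim s w'
    u.
Proof.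
move=> ww; have /andP[a0 a1] := along_itv s u; rewrite /circle_elim.
by case: ifP => _; apply: ww; apply/andP; split; lra.
Qed.

End Concatenation.

Section ElimHomotopy.
Context {R : realType} {V W : choiceType} {H : graph V} {K : graph W}.
Context {x : V} {y : W} {h : V} {k : W} (xh : H x h) (yk : K y k).
Let G := join_graph H K x y.
Let X := realization R (neighborhood_complex G).
Let A := realization R (neighborhood_complex H).
Let B := realization R (neighborhood_complex K).
Context (o : X) (p : A) (q : B).
Let E {Y : Type} (phiA : A -> Y) (phiB : B -> Y) (w0 w1 : R -> Y) : X -> Y :=
  join_elim (h := h) (k := k) p q phiA phiB w0 w1.

(** Paths enter only with parameters in [0, 1]. *)
Lemma join_elim_ext {Y : Type} (phiA phiA' : A -> Y) (phiB phiB' : B -> Y)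
    (w0 w0' w1 w1' : R -> Y) :
    phiA =1 phiA' -> phiB =1 phiB' ->
    (forall t, 0 <= t <= 1 -> w0 t = w0' t) ->
    (forall t, 0 <= t <= 1 -> w1 t = w1' t) ->
  E phiA phiB w0 w1 =1 E phiA' phiB' w0' w1'.
Proof.
move=> AA BB ww0 ww1 a; rewrite /E /join_elim /left_arm /right_arm /arm.
have /andP[a0 a1] := coord_itv a None.
case: pselect => la /=.
  by case: leP => a12; rewrite ?AA // ww0 //; apply/andP; split; lra.
case: pselect => ra /=; last by apply: ww1; exact: coord_itv.
by case: leP => a12; rewrite ?BB // ww0 //; apply/andP; split; lra.
Qed.

Section Homotopies.
Context {Y : topologicalType} (phiA : R -> A -> Y) (phiB : R -> B -> Y).
Context (w0 w1 : R -> R -> Y).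

Lemma join_elim_homot :
    continuous (fun z : A * R => phiA z.2 z.1) ->
    continuous (fun z : B * R => phiB z.2 z.1) ->
    continuous (fun z : R * R => w0 z.2 z.1) ->
    continuous (fun z : R * R => w1 z.2 z.1) ->
    (forall t, phiA t (vertex p h) = w0 t 0) ->
    (forall t, phiB t (vertex q k) = w0 t 1) ->
    (forall t, phiA t (vertex p x) = w1 t 0) ->
    (forall t, phiB t (vertex q y) = w1 t 1) ->
  homot (R := R) (E (phiA 0) (phiB 0) (w0 0) (w1 0))
                 (E (phiA 1) (phiB 1) (w0 1) (w1 1)).
Proof.
move=> cA cB c0 c1 w00 w01 w10 w11.
exists (fun z => E (phiA z.2) (phiB z.2) (w0 z.2) (w1 z.2) z.1); split => //.
exact: (continuous_join_elim xh yk o cA cB c0 c1).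
Qed.

End Homotopies.
End ElimHomotopy.

Section WedgeHomotopy.
Context {R : realType} {A B : topologicalType} (p : A) (q : B).
Context (s : euclidean_sphere R 2).

Definition wedge_circle_elim {Y : Type} (fA : A -> Y) (fB : B -> Y)
  (w : R -> Y) :
    wedge3 p q s -> Y :=
  wedge_elim fA fB (circle_elim s w).

Lemma wedge_circle_elim_ext {Y : Type} (fA fA' : A -> Y) (fB fB' : B -> Y)
    (w w' : R -> Y) :
    fA =1 fA' -> fB =1 fB' -> (forall t, 0 <= t <= 1 -> w t = w' t) ->
  wedge_circle_elim fA fB w =1 wedge_circle_elim fA' fB' w'.
Proof.
move=> /funext -> /funext -> ww a; rewrite /wedge_circle_elim.
by congr (wedge_elim _ _ _ a); apply/funext => u; exact: circle_elim_ext.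
Qed.

Lemma wedge_homot {Y : topologicalType} (fA : R -> A -> Y) (fB : R -> B -> Y)
    (w : R -> R -> Y) :
    continuous (fun z : A * R => fA z.2 z.1) ->
    continuous (fun z : B * R => fB z.2 z.1) ->
    continuous (fun z : R * R => w z.2 z.1) ->
    (forall t, fA t p = fB t q) -> (forall t, fA t p = w t 0) ->
    (forall t, fA t p = w t 1) ->
  homot (R := R) (wedge_circle_elim (fA 0) (fB 0) (w 0))
                 (wedge_circle_elim (fA 1) (fB 1) (w 1)).
Proof.
move=> cA cB cw AB A0 A1.
have w01 t : w t 0 = w t 1 by rewrite -A0 A1.
exists (fun z => wedge_circle_elim (fA z.2) (fB z.2) (w z.2) z.1); split => //.
apply: (continuous_wedge_elim (fS := fun t => circle_elim s (w t))) => //.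
  exact: continuous_circle_elim.
by move=> t; rewrite circle_elim_base.
Qed.

End WedgeHomotopy.

(** * The homotopy equivalence *)

Section Equivalence.
Context {R : realType} {V W : choiceType} {H : graph V} {K : graph W}.
Context {x : V} {y : W} {h : V} {k : W} (xh : H x h) (yk : K y k).
Let G := join_graph H K x y.
Let X := realization R (neighborhood_complex G).
Let A := realization R (neighborhood_complex H).
Let B := realization R (neighborhood_complex K).
Context (o : X) (p : A) (q : B) (s : euclidean_sphere R 2).
Let Wd := wedge3 p q s.

(* ga, ga' join the base point p to h and x, and de, de' join q to k and y. The
   function lam and the contraction hB are those of a neighborhood of q. *)
Context {ga ga' : R -> A} {de de' : R -> B} {lam : B -> R} {hB : B * R -> B}.
Context (cga : continuous ga) (ga0 : ga 0 = p) (ga1 : ga 1 = vertex p h).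
Context (cga' : continuous ga') (ga'0 : ga' 0 = p) (ga'1 : ga' 1 = vertex p x).
Context (cde : continuous de) (de0 : de 0 = q) (de1 : de 1 = vertex q k).
Context (cde' : continuous de') (de'0 : de' 0 = q) (de'1 : de' 1 = vertex q y).
Context (clam : continuous lam) (chB : continuous hB) (lamq : lam q = 1).
Context (hB0 : forall b, hB (b, 0) = b).
Context (hB1 : forall b, 1 / 2 <= lam b -> hB (b, 1) = q).
Context (hBq : forall t, hB (q, t) = q).

Let E {Y : Type} (phiA : A -> Y) (phiB : B -> Y) (w0 w1 : R -> Y) : X -> Y :=
  join_elim (h := h) (k := k) p q phiA phiB w0 w1.
Let WE {Y : Type} (fA : A -> Y) (fB : B -> Y) (w : R -> Y) : Wd -> Y :=
  wedge_circle_elim fA fB w.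
Let jA : A -> X := @left_incl R V W H K x y h o.
Let jB : B -> X := @right_incl R V W H K x y k o.
Let a0 : R -> X := @arc0 R V W H K x y h k o p q.
Let a1 : R -> X := @arc1 R V W H K x y h k o p q.
Let iA : A -> Wd := wedge_in0 p q s.
Let iB : B -> Wd := wedge_in1 p q s.
Let iS : euclidean_sphere R 2 -> Wd := wedge_in2 p q s.

Let cjA : continuous jA. Proof. exact: (continuous_side_incl (left_side xh)).
  Qed.
Let cjB : continuous jB. Proof. exact: (continuous_side_incl (right_side yk)).
  Qed.
Let ciA : continuous iA. Proof. exact: continuous_wedge_in0. Qed.
Let ciB : continuous iB. Proof. exact: continuous_wedge_in1. Qed.
Let ciS : continuous iS. Proof. exact: continuous_wedge_in2. Qed.
Let ca0 : continuous a0. Proof. exact: (continuous_arc0 xh yk). Qed.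
Let ca1 : continuous a1. Proof. exact: (continuous_arc1 xh yk). Qed.
Let a00 : a0 0 = jA (vertex p h). Proof. exact: arc0_0. Qed.
Let a01 : a0 1 = jB (vertex q k). Proof. exact: arc0_1. Qed.
Let a10 : a1 0 = jA (vertex p x). Proof. exact: arc1_0. Qed.
Let a11 : a1 1 = jB (vertex q y). Proof. exact: arc1_1. Qed.
Let iBA : iB q = iA p. Proof. exact: wedge_in01. Qed.
Let iSA : iS s = iA p. Proof. exact: wedge_in02. Qed.


Lemma continuous_rev {Y : topologicalType} (u : R -> Y) :
  continuous u -> continuous (fun t : R => u (1 - t)).
Proof. by move=> cu; apply: continuous_compose cu; contin. Qed.

(** The images of the two arcs: from h to the base point and on to k, with a
pause; and from x to the base point, around the circle, and on to y. *)
Definition to_wedge0 : R -> Wd :=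
  cat3 (fun t => iA (ga (1 - t))) (fun=> iA p) (fun t => iB (de t)).
Definition to_wedge1 : R -> Wd :=
  cat3 (fun t => iA (ga' (1 - t))) (fun t => iS (loop s t))
    (fun t => iB (de' t)).
Definition to_wedge : X -> Wd := E iA iB to_wedge0 to_wedge1.

(** The path from q to p along which the base point of B is brought to that of
A: q - k - z - h - p. *)
Definition bridge : R -> X :=
  cat3 (fun t => jB (de t)) (fun t => a0 (1 - t)) (fun t => jA (ga (1 - t))).
(** The inclusion of B with a neighborhood of q stretched along the bridge, up
to 1 - c of its length. Where lam is at most 1/2 the end of the contraction is
used, which is q for lam = 1/2, so that both pieces meet at q. *)
Definition pulled (c : R) (b : B) : X :=
  if lam b <= 1 / 2 then jB (hB (b, 1))
  else bridge ((1 - c) * clamp (2 * lam b - 1)).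
(** The closed path around the second arc: p - x - y - q and back over the
bridge, of which the last part is omitted as in [pulled]. *)
Definition round (c : R) : R -> X :=
  cat3 (fun t => jA (ga' t)) a1
    (cat3 (fun t => jB (de' (1 - t))) (fun=> jB q)
      (fun t => bridge ((1 - c) * t))).
Definition from_wedge : Wd -> X := WE jA (pulled 0) (round 0).

Lemma continuous_to_wedge0 : continuous to_wedge0.
Proof.
apply: continuous_cat3_path.
- exact: (continuous_compose (continuous_rev cga) ciA).
- exact: continuous_const.
- exact: (continuous_compose cde ciB).
- by rewrite subrr ga0.
- by rewrite de0 iBA.
Qed.

Lemma continuous_to_wedge1 : continuous to_wedge1.
Proof.
apply: continuous_cat3_path.
- exact: (continuous_compose (continuous_rev cga') ciA).
- exact: (continuous_compose (@continuous_loop R s) ciS).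
- exact: (continuous_compose cde' ciB).
- by rewrite subrr ga'0 loop0 iSA.
- by rewrite de'0 loop1 iBA iSA.
Qed.

Lemma to_wedge0_0 : to_wedge0 0 = iA (vertex p h).
Proof. by rewrite /to_wedge0 cat3_0 subr0 ga1. Qed.
Lemma to_wedge0_1 : to_wedge0 1 = iB (vertex q k).
Proof. by rewrite /to_wedge0 cat3_1 de1. Qed.
Lemma to_wedge1_0 : to_wedge1 0 = iA (vertex p x).
Proof. by rewrite /to_wedge1 cat3_0 subr0 ga'1. Qed.
Lemma to_wedge1_1 : to_wedge1 1 = iB (vertex q y).
Proof. by rewrite /to_wedge1 cat3_1 de'1. Qed.

Lemma continuous_to_wedge : continuous to_wedge.
Proof.
have c0 := continuous_to_wedge0; have c1 := continuous_to_wedge1.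
have cE := continuous_join_elim xh yk o (phiA := fun=> iA) (phiB := fun=> iB)
  (w0 := fun=> to_wedge0) (w1 := fun=> to_wedge1)
  (continuous_first ciA) (continuous_first ciB)
  (continuous_first c0) (continuous_first c1)
  (fun=> esym to_wedge0_0) (fun=> esym to_wedge0_1)
  (fun=> esym to_wedge1_0) (fun=> esym to_wedge1_1).
exact: (@continuous_at_param _ _ _ _ 0 cE).
Qed.

Lemma continuous_bridge : continuous bridge.
Proof.
apply: continuous_cat3_path.
- exact: (continuous_compose cde cjB).
- exact: (continuous_rev ca0).
- exact: (continuous_compose (continuous_rev cga) cjA).
- by rewrite subr0 de1 a01.
- by rewrite subrr subr0 ga1 a00.
Qed.

Lemma bridge0 : bridge 0 = jB q.
Proof. by rewrite /bridge cat3_0 de0. Qed.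
Lemma bridge1 : bridge 1 = jA p.
Proof. by rewrite /bridge cat3_1 subrr ga0. Qed.

Lemma pull_continuous {Y : topologicalType} (f : B -> Y) (c : R -> R -> Y) :
    continuous f -> continuous (fun z : R * R => c z.2 z.1) ->
    (forall t, c t 0 = f q) ->
  continuous (fun z : B * R => if lam z.1 <= 1 / 2 then f (hB (z.1, 1))
                               else c z.2 (clamp (2 * lam z.1 - 1))).
Proof.
move=> cf cc c0; apply: continuous_if.
- exact: continuous_first clam.
- exact: continuous_const.
- have cf1 : continuous (fun b => f (hB (b, 1))).
    exact: (continuous_compose (@continuous_at_param _ _ _ _ 1 chB) cf).
  exact: continuous_first cf1.
- have cl : continuous (fun z : B * R => lam z.1) := continuous_first clam.
  apply: (@continuous_compose _ _ _
    (fun z : B * R => (clamp (2 * lam z.1 - 1), z.2)) _ _ cc).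
  apply: continuous_pair; last exact: continuous_snd.
  have c2 : continuous (fun z : B * R => 2 * lam z.1 - 1) by contin.
  exact: (continuous_compose c2 continuous_clamp).
move=> z lz; rewrite hB1 ?lz //.
have -> : 2 * (1 / 2) - 1 = 0 :> R by lra.
by rewrite clamp0 c0.
Qed.

Lemma continuous_scaled_path {Y : topologicalType} (u : R -> Y) : continuous
  u ->
  continuous (fun z : R * R => u ((1 - z.2) * z.1)).
Proof. by move=> cu; apply: continuous_compose cu; contin. Qed.

Lemma continuous_pulled : continuous (fun z : B * R => pulled z.2 z.1).
Proof.
apply: (@pull_continuous _ jB (fun c t => bridge ((1 - c) * t)) cjB).
  exact: (continuous_scaled_path continuous_bridge).
by move=> t; rewrite mulr0 bridge0.
Qed.

Lemma pulled_base c : pulled c q = bridge (1 - c).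
Proof.
rewrite /pulled lamq ifF; last by apply/negbTE; rewrite -ltNge; lra.
have -> : 2 * 1 - 1 = 1 :> R by lra.
by rewrite clamp1 mulr1.
Qed.

Lemma continuous_round : continuous (fun z : R * R => round z.2 z.1).
Proof.
apply: (@continuous_cat3 _ _ (fun _ t => jA (ga' t)) (fun=> a1) (fun c =>
    cat3 (fun t => jB (de' (1 - t))) (fun=> jB q)
      (fun t => bridge ((1 - c) * t))))
  => [||||c].
- exact: continuous_first (continuous_compose cga' cjA).
- exact: continuous_first ca1.
- apply: (@continuous_cat3 _ _ (fun _ t => jB (de' (1 - t))) (fun _ _ => jB q)
    (fun c t => bridge ((1 - c) * t))) => [||||c].
  + exact: continuous_first (continuous_compose (continuous_rev cde') cjB).
  + exact: continuous_const.
  + exact: (continuous_scaled_path continuous_bridge).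
  + by rewrite subrr de'0.
  + by rewrite mulr0 bridge0.
- by rewrite ga'1 a10.
by rewrite cat3_0 subr0 a11 de'1.
Qed.

Lemma round_0 c : round c 0 = jA p.
Proof. by rewrite /round cat3_0 ga'0. Qed.
Lemma round_1 c : round c 1 = bridge (1 - c).
Proof. by rewrite /round !cat3_1 mulr1. Qed.

Lemma continuous_from_wedge : continuous from_wedge.
Proof.
have cp : continuous (pulled 0) := @continuous_at_param _ _ _ _ 0
  continuous_pulled.
have cr : continuous (round 0) := @continuous_at_param _ _ _ _ 0
  continuous_round.
have r01 : round 0 0 = round 0 1 by rewrite round_0 round_1 subr0 bridge1.
have cW : continuous (fun z : Wd * R => WE jA (pulled 0) (round 0) z.1).
  apply: (continuous_wedge_elim (fA := fun=> jA) (fB := fun=> pulled 0)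
    (fS := fun=> circle_elim s (round 0))).
  - exact: continuous_first cjA.
  - exact: continuous_first cp.
  - apply: (continuous_circle_elim (w := fun=> round 0)) => //.
    exact: continuous_first cr.
  - by rewrite pulled_base subr0 bridge1.
  - by move=> _; rewrite (circle_elim_base s r01) round_0.
exact: (@continuous_at_param _ _ _ _ 0 cW).
Qed.

Lemma to_wedge_left a : to_wedge (jA a) = iA a.
Proof. exact: (join_elim_left_incl xh). Qed.
Lemma to_wedge_right b : to_wedge (jB b) = iB b.
Proof. exact: (join_elim_right_incl yk). Qed.
Lemma to_wedge_arc0 t : 0 <= t <= 1 ->
  to_wedge (a0 t) = to_wedge0 (clamp (2 * t - 1 / 2)).
Proof.
exact: (join_elim_arc0 xh yk o to_wedge1 (esym to_wedge0_0) (esym to_wedge0_1)).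
Qed.
Lemma to_wedge_arc1 t : 0 <= t <= 1 -> to_wedge (a1 t) = to_wedge1 t.
Proof.
exact: (join_elim_arc1 xh yk o to_wedge0 (esym to_wedge1_0) (esym to_wedge1_1)).
Qed.

Lemma rev_itv (t : R) : 0 <= t <= 1 -> 0 <= 1 - t <= 1.
Proof. by case/andP => ? ?; apply/andP; split; lra. Qed.

(** The path from k over the base point to h, parametrized with the ends at -1
and 1. In the wedge, the bridge runs on it from 0 to -1, to 1 and back to 0,
as recorded by [fold_bridge]; so it can be contracted while its ends stay at
the base point. *)
Definition base_line : R -> Wd :=
  line3 (fun t => iB (de (- t))) (fun t => iA (ga t)) (fun t => iA (ga t)).
Definition fold0 : R -> R := cat3 (fun t => 1 - t) (fun=> 0) (fun t => - t).
Definition fold_bridge : R -> R :=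
  cat3 (fun t => - t) (fun t => fold0 (clamp (2 * (1 - t) - 1 / 2)))
    (fun t => 1 - t).

Lemma base_line_join : iB (de (- 0)) = iA (ga 0).
Proof. by rewrite oppr0 de0 ga0 iBA. Qed.

Lemma continuous_base_line : continuous base_line.
Proof.
apply: continuous_line3 => //; last exact: base_line_join.
- apply: (@continuous_compose _ _ _ (fun t : R => - t) (fun t => iB (de t))).
    by contin.
  exact: (continuous_compose cde ciB).
- exact: (continuous_compose cga ciA).
- exact: (continuous_compose cga ciA).
Qed.

Lemma base_line0 : base_line 0 = iA p.
Proof. by rewrite /base_line line3_l // oppr0 de0 iBA. Qed.

Lemma continuous_fold0 : continuous fold0.
Proof. by apply: continuous_cat3_path; contin; rewrite ?subrr ?oppr0. Qed.

Lemma continuous_fold_bridge : continuous fold_bridge.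
Proof.
apply: continuous_cat3_path; [by contin| |by contin| |].
- apply: (@continuous_compose _ _ _ (fun t : R => clamp (2 * (1 - t) - 1 / 2))
    fold0 _ continuous_fold0).
  apply: (@continuous_compose _ _ _ (fun t : R => 2 * (1 - t) - 1 / 2) clamp _
    continuous_clamp).
  by contin.
- rewrite subr0 /clamp min_l; last by lra.
  by rewrite max_r ?ler01 // /fold0 cat3_1.
- rewrite subrr subr0 /clamp min_r; last by lra.
  by rewrite max_l /fold0 ?cat3_0 ?subr0 //; lra.
Qed.

Lemma fold_bridge0 : fold_bridge 0 = 0.
Proof. by rewrite /fold_bridge cat3_0 oppr0. Qed.
Lemma fold_bridge1 : fold_bridge 1 = 0.
Proof. by rewrite /fold_bridge cat3_1 subrr. Qed.

Lemma to_wedge0_line t : 0 <= t <= 1 -> to_wedge0 t = base_line (fold0 t).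
Proof.
move=> t01; rewrite /fold0 (cat3_comp base_line).
apply: cat3_ext t01 => {}t t01.
- by rewrite /base_line line3_m ?rev_itv //; exact: base_line_join.
- by rewrite base_line0.
- by rewrite /base_line line3_l ?opprK //; case/andP: t01; lra.
Qed.

Lemma to_wedge_bridge t : 0 <= t <= 1 ->
  to_wedge (bridge t) = base_line (fold_bridge t).
Proof.
move=> t01; rewrite /bridge (cat3_comp to_wedge) (cat3_comp base_line).
apply: cat3_ext t01 => {}t t01.
- rewrite to_wedge_right /base_line line3_l ?opprK //.
  by case/andP: t01; lra.
- by rewrite to_wedge_arc0 ?rev_itv // to_wedge0_line // clamp_itv.
- rewrite to_wedge_left /base_line line3_m ?rev_itv //; exact: base_line_join.
Qed.

(** The path x - (base point) - y with the circle inserted, which occupies the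
parameters from 0 to 1. The image of [round] runs on it from 0 to -1, to 2 and
back to 1, before the bridge. *)
Definition loop_line : R -> Wd :=
  line3 (fun t => iA (ga' (- t))) (fun t => iS (loop s t))
    (fun t => iB (de' (t - 1))).
Definition fold1 : R -> R :=
  cat3 (fun t => t - 1) (fun t => t) (fun t => 1 + t).

Lemma loop_line_join0 : iA (ga' (- 0)) = iS (loop s 0).
Proof. by rewrite oppr0 ga'0 loop0 iSA. Qed.
Lemma loop_line_join1 : iS (loop s 1) = iB (de' (1 - 1)).
Proof. by rewrite subrr de'0 loop1 iSA iBA. Qed.

Lemma continuous_loop_line : continuous loop_line.
Proof.
apply: continuous_line3; last exact: loop_line_join1.
- apply: (@continuous_compose _ _ _ (fun t : R => - t) (fun t => iA (ga' t))).
    by contin.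
  exact: (continuous_compose cga' ciA).
- exact: (continuous_compose (@continuous_loop R s) ciS).
- apply: (@continuous_compose _ _ _ (fun t : R => t - 1) (fun t => iB (de' t))).
    by contin.
  exact: (continuous_compose cde' ciB).
- exact: loop_line_join0.
Qed.

Lemma loop_line0 : loop_line 0 = iA p.
Proof. by rewrite /loop_line line3_l // oppr0 ga'0. Qed.
Lemma loop_line1 : loop_line 1 = iA p.
Proof.
rewrite /loop_line line3_r //; last exact: loop_line_join1.
by rewrite subrr de'0 iBA.
Qed.

Lemma continuous_fold1 : continuous fold1.
Proof. by apply: continuous_cat3_path; contin; lra. Qed.

Lemma to_wedge1_line t : 0 <= t <= 1 -> to_wedge1 t = loop_line (fold1 t).
Proof.
move=> t01; rewrite /fold1 (cat3_comp loop_line).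
apply: cat3_ext t01 => {}t t01; case/andP: (t01) => t0 t1.
- by rewrite /loop_line line3_l ?opprB //; lra.
- by rewrite /loop_line line3_m //; exact: loop_line_join0.
- rewrite /loop_line line3_r;
  [by congr (iB (de' _)); lra|exact: loop_line_join1|].
  by lra.
Qed.

(** Contracting the excursions outside [0, 1] on [loop_line], and those of the
bridge on [base_line]. *)
Definition unwound_round (c : R) : R -> Wd :=
  cat3 (fun t => loop_line (slide (fun t => - t) (fun=> 0) c t))
    (fun t => loop_line (slide fold1 (fun t => t) c t))
    (cat3 (fun t => loop_line (slide (fun t => 2 - t) (fun=> 1) c t))
      (fun=> iA p) (fun t => base_line (slide fold_bridge (fun=> 0) c t))).

Definition unwound_pulled (c : R) (b : B) : Wd :=
  if lam b <= 1 / 2 then iB (hB (b, 1))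
  else base_line (slide fold_bridge (fun=> 0) c (clamp (2 * lam b - 1))).

Lemma to_from_start :
  WE iA (unwound_pulled 0) (unwound_round 0) =1 to_wedge \o from_wedge.
Proof.
move=> w; rewrite /= /from_wedge /WE /wedge_circle_elim
  (wedge_elim_comp to_wedge).
rewrite -/(wedge_circle_elim _ _ _ _) -[RHS]/(wedge_elim _ _ _ _).
have -> : (fun c => to_wedge (circle_elim s (round 0) c)) =
    circle_elim s (fun t => to_wedge (round 0 t)).
  by apply/funext => u; exact: circle_elim_comp.
apply: wedge_circle_elim_ext => [a|b|t t01].
- by rewrite to_wedge_left.
- rewrite /unwound_pulled /pulled; case: ifP => _;
  first by rewrite to_wedge_right.
  by rewrite slide0 subr0 mul1r to_wedge_bridge // clamp_itv.
rewrite /round (cat3_comp to_wedge); apply: cat3_ext t01 => {}t t01.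
- rewrite slide0 to_wedge_left /loop_line line3_l ?opprK //.
  by case/andP: t01; lra.
- by rewrite slide0 to_wedge_arc1 // to_wedge1_line.
rewrite (cat3_comp to_wedge); apply: cat3_ext t01 => {}t t01.
- rewrite slide0 to_wedge_right /loop_line line3_r.
  + by congr (iB (de' _)); lra.
  + exact: loop_line_join1.
  + by case/andP: t01; lra.
- by rewrite to_wedge_right iBA.
- by rewrite slide0 subr0 mul1r to_wedge_bridge.
Qed.

Lemma to_from_unwind :
  homot (R := R) (WE iA (unwound_pulled 0) (unwound_round 0))
    (WE iA (unwound_pulled 1) (unwound_round 1)).
Proof.
have [cb cl] := (continuous_base_line, continuous_loop_line).
have [cf1 cfb] := (continuous_fold1, continuous_fold_bridge).
apply: (@wedge_homot _ _ _ _ _ _ _ (fun=> iA)).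
- exact: continuous_first ciA.
- apply: (@pull_continuous _ iB
    (fun c t => base_line (slide fold_bridge (fun=> 0) c t)) ciB).
    by apply: continuous_slide => //; exact: continuous_const.
  by move=> t; rewrite slide_fix ?fold_bridge0 // base_line0 iBA.
- apply: (@continuous_cat3 _ _
    (fun c t => loop_line (slide (fun t => - t) (fun=> 0) c t))
    (fun c t => loop_line (slide fold1 (fun t => t) c t))
    (fun c => cat3 (fun t => loop_line (slide (fun t => 2 - t) (fun=> 1) c t))
      (fun=> iA p) (fun t => base_line (slide fold_bridge (fun=> 0) c t))))
    => [||||c].
  + by apply: continuous_slide => //; contin.
  + by apply: continuous_slide => //; contin.
  + apply: (@continuous_cat3 _ _
      (fun c t => loop_line (slide (fun t => 2 - t) (fun=> 1) c t))
      (fun _ _ => iA p)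
      (fun c t => base_line (slide fold_bridge (fun=> 0) c t))) => [||||c].
    * by apply: continuous_slide => //; contin.
    * exact: continuous_const.
    * by apply: continuous_slide => //; contin.
    * move=> c; rewrite slide_fix ?loop_line1 //; lra.
    * by rewrite slide_fix ?base_line0 // fold_bridge0.
  + by move=> c; congr loop_line; rewrite /slide /fold1 cat3_0; lra.
  + rewrite cat3_0; congr loop_line; rewrite /slide /fold1 cat3_1; lra.
- move=> t; rewrite /unwound_pulled lamq ifF; last by apply/negbTE;
  rewrite -ltNge; lra.
  have -> : 2 * 1 - 1 = 1 :> R by lra.
  by rewrite clamp1 slide_fix ?fold_bridge1 // base_line0.
- by move=> t; rewrite /unwound_round cat3_0 slide_fix ?oppr0 // loop_line0.
- by move=> t; rewrite /unwound_round !cat3_1 slide_fix ?fold_bridge1 //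
  base_line0.
Qed.

Definition pause : R -> R := cat3 (fun=> 0) (fun t => t) (fun=> 1).

(** What is left after unwinding is the contraction of the neighborhood of q,
which is undone, and pauses before and after the circle. *)
Lemma to_from_relax :
  homot (R := R) (WE iA (unwound_pulled 1) (unwound_round 1)) (fun w : Wd => w).
Proof.
have cS : continuous (fun t => iS (loop s t)).
  exact: (continuous_compose (@continuous_loop R s) ciS).
have cpause : continuous pause by apply: continuous_cat3_path; contin.
apply: (@homot_ext _ _ _
  (WE iA (fun b => iB (hB (b, 1 - 0)))
    (fun t => iS (loop s (slide pause (fun t => t) 0 t))))
  _ (WE iA (fun b => iB (hB (b, 1 - 1)))
    (fun t => iS (loop s (slide pause (fun t => t) 1 t))))).
- apply: wedge_circle_elim_ext => [//|b|t t01].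
    rewrite /unwound_pulled subr0; case: ifP => // /negbT; rewrite -ltNge => lb.
    by rewrite slide1 base_line0 hB1 ?iBA //; exact: ltW.
  rewrite slide0 /pause (cat3_comp (fun t => iS (loop s t))).
  apply: cat3_ext t01 => {}t t01.
  + by rewrite slide1 loop_line0 loop0 iSA.
  + by rewrite slide1 /loop_line line3_m //; exact: loop_line_join0.
  by rewrite /cat3 !slide1 loop1 iSA loop_line1 base_line0 !if_same.
- move=> w; rewrite -[RHS](wedge_elim_id w) /WE /wedge_circle_elim.
  rewrite subrr; have -> : (fun b => iB (hB (b, 0))) = iB.
    by apply/funext => b; rewrite hB0.
  congr (wedge_elim _ _ _ w); apply/funext => u.
  have -> : (fun t => iS (loop s (slide pause (fun t => t) 1 t))) =
      (fun t => iS (loop s t)) by apply/funext => t; rewrite slide1.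
  by rewrite -(circle_elim_comp s iS) circle_elim_id.
apply: (@wedge_homot _ _ _ _ _ _ _ (fun=> iA) (fun c b => iB (hB (b, 1 - c)))
  (fun c t => iS (loop s (slide pause (fun t => t) c t)))).
- exact: continuous_first ciA.
- apply: (@continuous_compose _ _ _ (fun z : B * R => hB (z.1, 1 - z.2)) iB _
  ciB).
  by apply: continuous_compose chB; contin.
- by apply: (continuous_slide (l := fun t => iS (loop s t))) => //; contin.
- by move=> t; rewrite hBq iBA.
- by move=> t; rewrite slide_fix /pause ?cat3_0 // loop0 iSA.
- by move=> t; rewrite slide_fix /pause ?cat3_1 // loop1 iSA.
Qed.

Lemma to_from_homot : homot (R := R) (to_wedge \o from_wedge) (fun w : Wd => w).
Proof.
apply: homot_trans to_from_relax.
by apply: homot_ext to_from_unwind => //; exact: to_from_start.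
Qed.

Lemma round_closed : round 0 0 = round 0 1.
Proof. by rewrite round_0 round_1 subr0 bridge1. Qed.
Lemma from_wedge_baseB : jA p = pulled 0 q.
Proof. by rewrite pulled_base subr0 bridge1. Qed.
Lemma from_wedge_baseS : jA p = circle_elim s (round 0) s.
Proof. by rewrite (circle_elim_base s round_closed) round_0. Qed.

Lemma from_wedge0 a : from_wedge (iA a) = jA a.
Proof. exact: wedge_elim0 from_wedge_baseB from_wedge_baseS a. Qed.
Lemma from_wedge1 b : from_wedge (iB b) = pulled 0 b.
Proof. exact: wedge_elim1 from_wedge_baseB from_wedge_baseS b. Qed.
Lemma from_wedge_loop t : 0 <= t <= 1 -> from_wedge (iS (loop s t)) = round 0 t.
Proof.
move=> t01; rewrite /from_wedge /WE /wedge_circle_elim.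
rewrite (wedge_elim2 from_wedge_baseB from_wedge_baseS).
exact: circle_elim_loop round_closed t01.
Qed.

(** While the base point q is moved back from p along the bridge, the paths
from h to k and from x to y that stand for the arcs must follow it: they gain,
respectively lose, the part of the bridge traversed. *)
Definition gate0 (c : R) : R -> X :=
  cat3 (fun t => jA (ga (1 - t))) (fun t => bridge (1 - c * t))
    (fun t => pulled c (de t)).
Definition gate1 (c : R) : R -> X :=
  cat3 (fun t => jA (ga' (1 - t))) (round c) (fun t => pulled c (de' t)).

Lemma from_to_start :
  E jA (pulled 0) (gate0 0) (gate1 0) =1 from_wedge \o to_wedge.
Proof.
move=> a; rewrite /= /to_wedge /E (join_elim_comp p q from_wedge).
apply: join_elim_ext => [b|b|t t01|t t01].
- by rewrite from_wedge0.
- by rewrite from_wedge1.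
- rewrite /to_wedge0 (cat3_comp from_wedge); apply: cat3_ext t01 => {}t t01.
  + by rewrite from_wedge0.
  + by rewrite from_wedge0 mul0r subr0 bridge1.
  + by rewrite from_wedge1.
- rewrite /to_wedge1 (cat3_comp from_wedge); apply: cat3_ext t01 => {}t t01.
  + by rewrite from_wedge0.
  + by rewrite from_wedge_loop.
  + by rewrite from_wedge1.
Qed.

Lemma continuous_pulled_path (u : R -> B) : continuous u ->
  continuous (fun z : R * R => pulled z.2 (u z.1)).
Proof.
move=> cu; apply: (@continuous_compose _ _ _ (fun z : R * R => (u z.1, z.2)) _ _
  continuous_pulled).
by apply: continuous_pair; [exact: continuous_first cu|exact: continuous_snd].
Qed.

Lemma from_to_pull :
  homot (R := R) (E jA (pulled 0) (gate0 0) (gate1 0))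
    (E jA (pulled 1) (gate0 1) (gate1 1)).
Proof.
apply: (@join_elim_homot _ _ _ _ _ _ _ _ _ xh yk o p q _ (fun=> jA)).
- exact: continuous_first cjA.
- exact: continuous_pulled.
- apply: (@continuous_cat3 _ _ (fun _ t => jA (ga (1 - t)))
    (fun c t => bridge (1 - c * t)) (fun c t => pulled c (de t))) => [||||c].
  + exact: continuous_first (continuous_compose (continuous_rev cga) cjA).
  + by apply: continuous_compose continuous_bridge; contin.
  + exact: continuous_pulled_path.
  + by move=> c; rewrite mulr0 subr0 subrr ga0 bridge1.
  + by rewrite mulr1 de0 pulled_base.
- apply: (@continuous_cat3 _ _ (fun _ t => jA (ga' (1 - t)))
    round (fun c t => pulled c (de' t))) => [||||c].
  + exact: continuous_first (continuous_compose (continuous_rev cga') cjA).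
  + exact: continuous_round.
  + exact: continuous_pulled_path.
  + by move=> c; rewrite subrr ga'0 round_0.
  + by rewrite de'0 pulled_base round_1.
- by move=> t; rewrite /gate0 cat3_0 subr0 ga1.
- by move=> t; rewrite /gate0 cat3_1 de1.
- by move=> t; rewrite /gate1 cat3_0 subr0 ga'1.
- by move=> t; rewrite /gate1 cat3_1 de'1.
Qed.

(** Once q is back, the contraction of its neighborhood is undone. *)
Definition settle0 (c : R) : R -> X :=
  cat3 (fun t => jA (ga (1 - t))) (fun t => bridge (1 - t))
    (fun t => jB (hB (de t, 1 - c))).
Definition settle1 (c : R) : R -> X :=
  cat3 (fun t => jA (ga' (1 - t))) (round 1) (fun t => jB (hB (de' t, 1 - c))).

Lemma pulled_end b : pulled 1 b = jB (hB (b, 1)).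
Proof.
rewrite /pulled; case: ifP => // /negbT; rewrite -ltNge => lb.
by rewrite subrr mul0r bridge0 hB1 //; exact: ltW.
Qed.

Lemma from_to_settle_start :
  E jA (fun b => jB (hB (b, 1 - 0))) (settle0 0) (settle1 0) =1
  E jA (pulled 1) (gate0 1) (gate1 1).
Proof.
apply: join_elim_ext => [//|b|t t01|t t01]; first by rewrite pulled_end subr0.
- apply: cat3_ext t01 => {}t t01 //; first by rewrite mul1r.
  by rewrite pulled_end subr0.
- by apply: cat3_ext t01 => {}t t01 //; rewrite pulled_end subr0.
Qed.

Lemma continuous_settled_path (u : R -> B) : continuous u ->
  continuous (fun z : R * R => jB (hB (u z.1, 1 - z.2))).
Proof.
move=> cu; apply: (@continuous_compose _ _ _
  (fun z : R * R => hB (u z.1, 1 - z.2)) jB _ cjB).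
apply: (@continuous_compose _ _ _ (fun z : R * R => (u z.1, 1 - z.2)) hB _ chB).
by apply: continuous_pair; [exact: continuous_first cu|contin].
Qed.

Lemma from_to_settle :
  homot (R := R) (E jA (fun b => jB (hB (b, 1 - 0))) (settle0 0) (settle1 0))
    (E jA (fun b => jB (hB (b, 1 - 1))) (settle0 1) (settle1 1)).
Proof.
have cr1 : continuous (round 1) := @continuous_at_param _ _ _ _ 1
  continuous_round.
apply: (@join_elim_homot _ _ _ _ _ _ _ _ _ xh yk o p q _ (fun=> jA)
  (fun c b => jB (hB (b, 1 - c)))).
- exact: continuous_first cjA.
- apply: (@continuous_compose _ _ _ (fun z : B * R => hB (z.1, 1 - z.2)) jB _
  cjB).
  by apply: continuous_compose chB; contin.
- apply: (@continuous_cat3 _ _ (fun _ t => jA (ga (1 - t)))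
    (fun _ t => bridge (1 - t)) (fun c t => jB (hB (de t, 1 - c)))) => [||||c].
  + exact: continuous_first (continuous_compose (continuous_rev cga) cjA).
  + exact: continuous_first (continuous_rev continuous_bridge).
  + exact: continuous_settled_path.
  + by move=> _; rewrite subr0 subrr ga0 bridge1.
  + by rewrite subrr bridge0 de0 hBq.
- apply: (@continuous_cat3 _ _ (fun _ t => jA (ga' (1 - t)))
    (fun=> round 1) (fun c t => jB (hB (de' t, 1 - c)))) => [||||c].
  + exact: continuous_first (continuous_compose (continuous_rev cga') cjA).
  + exact: continuous_first cr1.
  + exact: continuous_settled_path.
  + by move=> _; rewrite subrr ga'0 round_0.
  + by rewrite de'0 hBq round_1 subrr bridge0.
- by move=> t; rewrite /settle0 cat3_0 subr0 ga1.
- by move=> t; rewrite /settle0 cat3_1 de1.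
- by move=> t; rewrite /settle1 cat3_0 subr0 ga'1.
- by move=> t; rewrite /settle1 cat3_1 de'1.
Qed.

(** The paths p - h - z - k - q and p - x - y - q, with the arc on [0, 1].
What has become of the two arcs are reparametrizations of these paths,
[trace0] and [trace1], with ends 0 and 1; straightening them leaves the arcs.
*)
Definition line0 : R -> X :=
  line3 (fun t => jA (ga (1 + t))) a0 (fun t => jB (de (2 - t))).
Definition line1 : R -> X :=
  line3 (fun t => jA (ga' (1 + t))) a1 (fun t => jB (de' (2 - t))).

Lemma line0_join0 : jA (ga (1 + 0)) = a0 0.
Proof. by rewrite addr0 ga1 a00. Qed.
Lemma line0_join1 : a0 1 = jB (de (2 - 1)).
Proof. by rewrite (_ : 2 - 1 = 1 :> R) ?de1 ?a01 //; lra. Qed.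
Lemma line1_join0 : jA (ga' (1 + 0)) = a1 0.
Proof. by rewrite addr0 ga'1 a10. Qed.
Lemma line1_join1 : a1 1 = jB (de' (2 - 1)).
Proof. by rewrite (_ : 2 - 1 = 1 :> R) ?de'1 ?a11 //; lra. Qed.

Lemma continuous_tail (ua : R -> A) (ub : R -> B) :
    continuous ua -> continuous ub ->
  continuous (fun t : R => jA (ua (1 + t))) /\
  continuous (fun t : R => jB (ub (2 - t))).
Proof.
move=> ca cb; split.
  apply: (@continuous_compose _ _ _ (fun t : R => 1 + t) (fun t => jA (ua t))).
    by contin.
  exact: (continuous_compose ca cjA).
apply: (@continuous_compose _ _ _ (fun t : R => 2 - t) (fun t => jB (ub t))).
  by contin.
exact: (continuous_compose cb cjB).
Qed.

Lemma continuous_line0 : continuous line0.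
Proof.
have [? ?] := continuous_tail cga cde.
by apply: continuous_line3 => //; [exact: line0_join0|exact: line0_join1].
Qed.

Lemma continuous_line1 : continuous line1.
Proof.
have [? ?] := continuous_tail cga' cde'.
by apply: continuous_line3 => //; [exact: line1_join0|exact: line1_join1].
Qed.

Definition trace_bridge : R -> R :=
  cat3 (fun t => 2 - t) (fun t => 1 - t) (fun t => - t).
Definition trace0 : R -> R :=
  cat3 (fun t => - t) (fun t => trace_bridge (1 - t)) (fun t => 2 - t).
Definition trace1 : R -> R :=
  cat3 (fun t => - t)
    (cat3 (fun t => t - 1) (fun t => t)
      (cat3 (fun t => 1 + t) (fun=> 2) (fun=> 2)))
    (fun t => 2 - t).

Lemma continuous_trace0 : continuous trace0.
Proof.
have cb : continuous trace_bridge by apply: continuous_cat3_path; contin; lra.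
apply: continuous_cat3_path; [by contin|exact: continuous_rev|by contin| |].
  by rewrite subr0 /trace_bridge cat3_1.
by rewrite subrr /trace_bridge cat3_0.
Qed.

Lemma continuous_trace1 : continuous trace1.
Proof.
apply: continuous_cat3_path; [by contin| |by contin| |].
- apply: continuous_cat3_path; [by contin|by contin| | |].
  + by apply: continuous_cat3_path; contin; lra.
  + by lra.
  + by rewrite cat3_0; lra.
- by rewrite cat3_0; lra.
- by rewrite !cat3_1; lra.
Qed.

Lemma line0_left t : 0 <= t <= 1 -> jA (ga (1 - t)) = line0 (- t).
Proof. by case/andP => t0 _; rewrite /line0 line3_l //; lra. Qed.
Lemma line0_right t : 0 <= t <= 1 -> jB (de t) = line0 (2 - t).
Proof.
case/andP => t0 t1; rewrite /line0 line3_r; last by lra.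
  by congr (jB (de _)); lra.
exact: line0_join1.
Qed.
Lemma line1_left t : 0 <= t <= 1 -> jA (ga' (1 - t)) = line1 (- t).
Proof. by case/andP => t0 _; rewrite /line1 line3_l //; lra. Qed.
Lemma line1_right t : 0 <= t <= 1 -> jB (de' t) = line1 (2 - t).
Proof.
case/andP => t0 t1; rewrite /line1 line3_r; last by lra.
  by congr (jB (de' _)); lra.
exact: line1_join1.
Qed.

Lemma bridge_line0 t : 0 <= t <= 1 -> bridge t = line0 (trace_bridge t).
Proof.
move=> t01; rewrite /trace_bridge (cat3_comp line0).
apply: cat3_ext t01 => {}t t01; first exact: line0_right.
  by rewrite /line0 line3_m ?rev_itv //; exact: line0_join0.
exact: line0_left.
Qed.

Lemma from_to_straighten_start :
  E jA jB (fun t => line0 (slide trace0 (fun t => t) 0 t))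
    (fun t => line1 (slide trace1 (fun t => t) 0 t)) =1
  E jA (fun b => jB (hB (b, 1 - 1))) (settle0 1) (settle1 1).
Proof.
have de'E t : jB (hB (de' t, 1 - 1)) = jB (de' t) by rewrite subrr hB0.
have deE t : jB (hB (de t, 1 - 1)) = jB (de t) by rewrite subrr hB0.
apply: join_elim_ext => [//|b|t t01|t t01]; first by rewrite subrr hB0.
- rewrite slide0 /trace0 (cat3_comp line0); apply: cat3_ext t01 => {}t t01.
  + by rewrite line0_left.
  + by rewrite bridge_line0 ?rev_itv.
  + by rewrite deE line0_right.
- rewrite slide0 /trace1 (cat3_comp line1); apply: cat3_ext t01 => {}t t01.
  + by rewrite line1_left.
  + rewrite (cat3_comp line1); apply: cat3_ext t01 => {}t t01.
    * have := line1_left (rev_itv t01); rewrite opprB => <-.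
      by congr (jA (ga' _)); lra.
    * by rewrite /line1 line3_m //; exact: line1_join0.
    have jBq : line1 2 = jB q.
      have := @line1_right 0; rewrite subr0 de'0 => -> //.
      by rewrite lexx ler01.
    rewrite (cat3_comp line1); apply: cat3_ext t01 => {}t t01.
    * by rewrite (line1_right (rev_itv t01)); congr line1; lra.
    * by rewrite jBq.
    * by rewrite subrr mul0r bridge0 jBq.
  + by rewrite de'E line1_right.
Qed.

Lemma from_to_straighten :
  homot (R := R) (E jA jB (fun t => line0 (slide trace0 (fun t => t) 0 t))
      (fun t => line1 (slide trace1 (fun t => t) 0 t)))
    (E jA jB (fun t => line0 (slide trace0 (fun t => t) 1 t))
      (fun t => line1 (slide trace1 (fun t => t) 1 t))).
Proof.
have tr00 : trace0 0 = 0 by rewrite /trace0 cat3_0 oppr0.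
have tr01 : trace0 1 = 1 by rewrite /trace0 cat3_1; lra.
have tr10 : trace1 0 = 0 by rewrite /trace1 cat3_0 oppr0.
have tr11 : trace1 1 = 1 by rewrite /trace1 cat3_1; lra.
have [ct0 ct1] := (continuous_trace0, continuous_trace1).
apply: (@join_elim_homot _ _ _ _ _ _ _ _ _ xh yk o p q _ (fun=> jA) (fun=> jB)
  (fun c t => line0 (slide trace0 (fun t => t) c t))
  (fun c t => line1 (slide trace1 (fun t => t) c t))).
- exact: continuous_first cjA.
- exact: continuous_first cjB.
- by apply: continuous_slide => //; [exact: continuous_line0|contin].
- by apply: continuous_slide => //; [exact: continuous_line1|contin].
- by move=> t; rewrite slide_fix // /line0 line3_l // line0_join0 a00.
- move=> t; rewrite slide_fix // /line0 line3_m ?a01 ?ler01 ?lexx //.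
  exact: line0_join0.
- by move=> t; rewrite slide_fix // /line1 line3_l // line1_join0 a10.
- move=> t; rewrite slide_fix // /line1 line3_m ?a11 ?ler01 ?lexx //.
  exact: line1_join0.
Qed.

Lemma from_to_homot : homot (R := R) (from_wedge \o to_wedge) (fun a : X => a).
Proof.
apply: (homot_trans (g := E jA (pulled 1) (gate0 1) (gate1 1))).
  by apply: homot_ext from_to_pull => //; exact: from_to_start.
apply: (homot_trans (g := E jA (fun b => jB (hB (b, 1 - 1))) (settle0 1)
  (settle1 1))).
  by apply: homot_ext from_to_settle => //; exact: from_to_settle_start.
apply: (homot_trans (g := E jA jB a0 a1));
  last exact: (join_elim_canonical_homot xh yk).
apply: homot_ext from_to_straighten; first exact: from_to_straighten_start.
apply: join_elim_ext => // t t01; rewrite slide1.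
- by rewrite /line0 line3_m //; exact: line0_join0.
- by rewrite /line1 line3_m //; exact: line1_join0.
Qed.

End Equivalence.

(** * Connectivity *)

Section JoinGraph.
Context {V W : choiceType} {H : graph V} {K : graph W} (x : V) (y : W).

Lemma join_not_bipartite : ~ bipartite H -> ~ bipartite (join_graph H K x y).
Proof.
move=> nbH [c cP]; apply: nbH; exists (fun v => c (Some (inl v))) => u v uv.
exact: cP.
Qed.

Lemma join_connected :
  connected_graph H -> connected_graph K -> connected_graph
    (join_graph H K x y).
Proof.
move=> cH cK.
have walkl (u v : V) : exists b, reach (join_graph H K x y) b (Some (inl u))
  (Some (inl v)).
  have [p up <-] := cH u v; exists (odd (size p)),
    (map (fun a => Some (inl a)) p).
  split; [|by rewrite (last_map (fun a => Some (inl a)))|by rewrite size_map].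
  by rewrite path_map; apply: sub_path up => a b.
have walkr (u v : W) : exists b, reach (join_graph H K x y) b (Some (inr u))
  (Some (inr v)).
  have [p up <-] := cK u v; exists (odd (size p)),
    (map (fun a => Some (inr a)) p).
  split; [|by rewrite (last_map (fun a => Some (inr a)))|by rewrite size_map].
  by rewrite path_map; apply: sub_path up => a b.
have to_apex c : exists b, reach (join_graph H K x y) b c None.
  case: c => [[v|w]|]; last by exists false, [::].
    have [b vx] := walkl v x; exists (b (+) true); apply: reach_trans vx _.
    by apply: reach_edge => /=.
  have [b wy] := walkr w y; exists (b (+) true); apply: reach_trans wy _.
  by apply: reach_edge => /=.
move=> c d; have [b cN] := to_apex c; have [b' dN] := to_apex d.
have [p [cp pd _]] := reach_trans cN (reach_sym dN).
by exists p.
Qed.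

End JoinGraph.

Section Connectivity.
Context {R : realType}.

(** The sphere of dimension 0 consists of the two points 1 and -1. *)
Lemma path_connected_k_connected (X : topologicalType) (o : X) :
  (forall a b : X, path_joined (R := R) a b) -> k_connected R X 0.
Proof.
move=> pX [|[|n]] // _ f cf.
  exists (fun=> o); first exact: continuous_const.
  move=> u v; exfalso; have := set_mem (valP v).
  by rewrite /euclidean_sphere /= big_ord0 => /eqP; rewrite eq_sym oner_eq0.
have sphere1 (c : R) : c ^+ 2 = 1 -> euclidean_sphere R 1 (const_mx c).
  by move=> c1; rewrite /euclidean_sphere /= big_ord1 mxE.
have m1 : (-1 : R) ^+ 2 = 1 by rewrite sqrrN expr1n.
pose v0 : euclidean_sphere R 1 := exist _ (const_mx (-1))
  (mem_set (sphere1 _ m1)).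
pose v1 : euclidean_sphere R 1 := exist _ (const_mx 1)
  (mem_set (sphere1 _ (expr1n R 2))).
have [g [cg g0 g1]] := pX (f v0) (f v1).
exists (fun u : euclidean_ball R 1 => g ((\val u ord0 ord0 + 1) / 2)).
  have ce : continuous (fun u : euclidean_ball R 1 => \val u ord0 ord0).
    exact: continuous_entry.
  by apply: continuous_compose cg; contin.
move=> u v ->; have : \val v ord0 ord0 ^+ 2 = 1.
  by have := set_mem (valP v); rewrite /euclidean_sphere /= big_ord1.
have vE c (w : euclidean_sphere R 1) : \val w = const_mx c -> \val v ord0 ord0
  = c -> v = w.
  move=> wE vc; apply: val_inj; rewrite wE; apply/rowP => i.
  by rewrite (ord1 i) vc mxE.
move=> /eqP; rewrite sqrf_eq1 => /orP[] /eqP vc.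
  rewrite vc (vE _ v1 erefl vc) -g1; congr g; lra.
rewrite vc (vE _ v0 erefl vc) -g0; congr g; lra.
Qed.

Lemma homot_compose {X X' Y Y' : topologicalType} (f g : X -> Y) (a : X' -> X)
    (b : Y -> Y') :
  continuous a -> continuous b -> homot (R := R) f g ->
  homot (R := R) (fun z => b (f (a z))) (fun z => b (g (a z))).
Proof.
move=> ca cb [F [cF F0 F1]]; exists (fun z => b (F (a z.1, z.2))).
split=> [|z|z] /=; [|by rewrite F0|by rewrite F1].
apply: (@continuous_compose _ _ _ (fun z : X' * R => F (a z.1, z.2)) b _ cb).
apply: (@continuous_compose _ _ _ (fun z : X' * R => (a z.1, z.2)) F _ cF).
apply: continuous_pair; last exact: continuous_snd.
exact: continuous_first ca.
Qed.

(** Contract the sphere to the center of the ball. *)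
Lemma ball_map_null {X : topologicalType} n (D : euclidean_ball R n -> X)
    (f : euclidean_sphere R n -> X) :
    continuous D ->
    (forall u v, \val u = \val v -> D u = f v) ->
  exists c, homot (R := R) f (fun=> c).
Proof.
move=> cD Df.
have scaleP (v : euclidean_sphere R n) c : euclidean_ball R n
  (clamp c *: \val v).
  rewrite /euclidean_ball /=.
  have -> : \sum_(i < n) (clamp c *: \val v) ord0 i ^+ 2 = clamp c ^+ 2.
    under eq_bigr do rewrite mxE exprMn.
    by rewrite -mulr_sumr (set_mem (valP v)) mulr1.
  by have /andP[c0 c1] := clamp_itv c; rewrite expr_le1.
pose scale v c : euclidean_ball R n := exist _ (clamp c *: \val v)
  (mem_set (scaleP v c)).
have cs : continuous (fun z : euclidean_sphere R n * R => scale z.1 (1 - z.2)).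
  apply: continuous_into_set; apply: continuous_into_matrix => i j.
  apply: (@continuous_ext _ _ (fun z : euclidean_sphere R n * R =>
    clamp (1 - z.2) * \val z.1 i j)) => [z|]; first by rewrite /= mxE.
  apply: continuous_mul.
    apply: (@continuous_compose _ _ _
      (fun z : euclidean_sphere R n * R => 1 - z.2)
      clamp _ continuous_clamp).
    by contin.
  exact: continuous_first (@continuous_entry _ _ _ _ i j).
have zeroP : euclidean_ball R n 0.
  by rewrite /euclidean_ball /= big1 // => i _; rewrite mxE expr0n.
exists (D (exist _ 0 (mem_set zeroP))).
exists (fun z => D (scale z.1 (1 - z.2))); split => [|v|v] /=.
- exact: (continuous_compose cs cD).
- by apply: Df; rewrite /= subr0 clamp1 scale1r.
- by congr D; apply: val_inj; rewrite /= subrr clamp0 scale0r.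
Qed.

(** An extension of [e] to the disk would make the identity of the circle
homotopic to a constant. *)
Lemma circle_retract_not_simply_connected (X : topologicalType) (l : int)
    (e : euclidean_sphere R 2 -> X) (r : X -> euclidean_sphere R 2) :
    continuous e -> continuous r ->
    homot (R := R) (fun u => r (e u)) (fun u => u) ->
  k_connected R X l -> l <= 0.
Proof.
move=> ce cr rel kX; rewrite leNgt; apply/negP => l0.
have [//|D cD De] := kX 2 _ e ce.
have [c ec] := ball_map_null cD De.
apply: (@no_contraction R (r c)).
apply: (homot_trans (homot_sym rel)).
exact: (homot_compose (a := fun u => u) continuous_ident cr ec).
Qed.

Lemma circle_inhabited : exists s : euclidean_sphere R 2, True.
Proof.
have P : euclidean_sphere R 2 (row2 1 0).
  by apply/euclidean_sphere2; rewrite !mxE /= expr1n expr0n addr0.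
by exists (exist _ (row2 1 0) (mem_set P)).
Qed.

Context {V W : choiceType} {H : graph V} {K : graph W} {x : V} {y : W}.
Let G := join_graph H K x y.
Let X := realization R (neighborhood_complex G).
Let A := realization R (neighborhood_complex H).
Let B := realization R (neighborhood_complex K).

Lemma realization_inhabited {U : choiceType} (L : graph U) (u v : U) : L u v ->
  exists a : realization R (neighborhood_complex L), True.
Proof.
move=> uv; have Pu : (\bigcup_(s in simplices (neighborhood_complex L))
    @closed_simplex R U s) (vertex_coord u).
  exists [fset u]%fset; last by apply: closed_simplex_vertex; rewrite inE.
  by apply: (@neighborhood_simplex _ L v) => w; rewrite inE => /eqP ->.
by exists (exist _ (vertex_coord u) (mem_set Pu)).
Qed.

Lemma join_homotopy_equivalence (p : A) (q : B) (s : euclidean_sphere R 2) :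
    connected_graph H -> ~ bipartite H -> connected_graph K -> ~ bipartite K ->
  exists (f : X -> wedge3 p q s) (g : wedge3 p q s -> X),
    [/\ continuous f, continuous g, homot (R := R) (g \o f) idfun &
        homot (R := R) (f \o g) idfun].
Proof.
move=> cH nbH cK nbK.
have [h xh] := exists_neighbor cH nbH x.
have [k yk] := exists_neighbor cK nbK y.
have [o _] : exists o : X, True.
  by apply: (@realization_inhabited _ G (Some (inl x)) None) => /=; exact: eqxx.
have [ga [cga ga0 ga1]] := path_connected_neighborhood p (vertex p h) cH nbH.
have [ga' [cga' ga'0 ga'1]] := path_connected_neighborhood p (vertex p x) cH
  nbH.
have [de [cde de0 de1]] := path_connected_neighborhood q (vertex q k) cK nbK.
have [de' [cde' de'0 de'1]] := path_connected_neighborhood q (vertex q y) cK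
  nbK.
have [lam [hB [[clam chB] lamq hB0 hB1 hBq]]] := well_pointed q.
exists (@to_wedge R V W H K x y h k p q s ga ga' de de').
exists (@from_wedge R V W H K x y h k o p q s ga ga' de de' lam hB); split.
- by apply: continuous_to_wedge.
- by apply: continuous_from_wedge.
- by apply: from_to_homot.
- by apply: to_from_homot.
Qed.

End Connectivity.

Theorem theorem2 (R : realType) (V W : choiceType) (H : graph V) (K : graph W)
    (x : V) (y : W) :
  connected_graph H -> ~ bipartite H ->
  connected_graph K -> ~ bipartite K ->
  (forall (p : realization R (neighborhood_complex H))
          (q : realization R (neighborhood_complex K))
          (s : euclidean_sphere R 2),
      homotopy_equivalent R
        (realization R (neighborhood_complex (join_graph H K x y)))
        (wedge3 p q s)) /\
  has_connectivity R
    (realization R (neighborhood_complex (join_graph H K x y))) 0%R.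
Proof.
move=> cH nbH cK nbK; split=> [p q s|].
  have [f [g [cf cg gf fg]]] := @join_homotopy_equivalence R V W H K x y p q s
    cH nbH cK nbK.
  by exists f, g; split => //; exact: homot_homotopic.
have [h xh] := exists_neighbor cH nbH x.
have [k yk] := exists_neighbor cK nbK y.
have [p _] := @realization_inhabited R _ _ _ _ xh.
have [q _] := @realization_inhabited R _ _ _ _ yk.
have [s _] := @circle_inhabited R.
have [f [g [cf cg gf fg]]] := @join_homotopy_equivalence R V W H K x y p q s cH
  nbH cK nbK.
split=> [|l].
  apply: (path_connected_k_connected (g (wedge_in0 p q s p))) => a b.
  apply: path_connected_neighborhood; first exact: join_connected.
  exact: join_not_bipartite.
(* Collapsing A and B makes the circle a retract of the wedge. *)
pose collapse : wedge3 p q s -> euclidean_sphere R 2 :=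
  wedge_elim (fun=> s) (fun=> s) id.
have ccollapse : continuous collapse.
  apply: (@continuous_at_param R _ _ (fun z => collapse z.1) 0).
  apply: (continuous_wedge_elim (fA := fun _ _ => s) (fB := fun _ _ => s)
    (fS := fun=> id)) => //.
  - exact: continuous_const.
  - exact: continuous_const.
  - exact: continuous_fst.
apply: (circle_retract_not_simply_connected
  (e := fun u => g (wedge_in2 p q s u)) (r := fun a => collapse (f a))).
- exact: continuous_compose (@continuous_wedge_in2 _ _ _ p q s) cg.
- exact: continuous_compose cf ccollapse.
apply: homot_ext (homot_compose (@continuous_wedge_in2 _ _ _ p q s) ccollapse
  fg).
  by [].
by move=> u; rewrite /collapse /= wedge_elim2.
Qed.
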